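(* Suppose there is a constant $C_{\mathcal T\mathcal J}>0$ such that $\tau_n\ge C_{\mathcal T\mathcal J}h_K^2$ for all $n\in\{1,\dots,N\}$ and all $K\in\mathcal T$. Then for each $i\in\{1,2\}$ and every $v\in\mathbb V_i$, $$\sup_{w\in\mathbb V\setminus\{0\}}\frac{\int_0^T\big[(\partial_t\mathcal I_iv,w)_\Omega-(\partial_t\mathcal I_iv,w)_{\Omega,h}\big]dt}{\|w\|_X}\le C\,\|v-\mathcal I_iv\|_X,$$ where $C>0$ depends only on $C_{\mathcal T\mathcal J}$.
   Context: Let $d\in\mathbb N$, let $\Omega\subset\mathbb R^d$ be a bounded connected open set with Lipschitz boundary, $T>0$. $(\cdot,\cdot)_\Omega$, $\|\cdot\|_\Omega$ are the $L^2(\Omega)$ inner product and norm. $X=L^2(0,T;H^1_0(\Omega))$ with $\|w\|_X^2=\int_0^T\|\nabla w\|_\Omega^2\,dt$. $\mathcal T$ is a conforming simplicial mesh of $\Omega$, $h_K=\operatorname{diam}K$ for $K\in\mathcal T$, and $V_h=\{v\in H^1_0(\Omega): v|_K\in\mathcal P_1(K)\ \forall K\in\mathcal T\}$ with nodal (hat function) basis $\{\varphi_z\}_{z\in\mathcal V^I}$, where $\mathcal V^I$ is the set of vertices of $\mathcal T$ lying in $\Omega$. The mass-lumped inner product on $V_h$ is $(v_h,w_h)_{\Omega,h}=\sum_{z\in\mathcal V^I}(\varphi_z,1)_\Omega\,v_h(z)w_h(z)$. Let $0=t_0<t_1<\dots<t_N=T$, $I_n=(t_{n-1},t_n)$, $\tau_n=t_n-t_{n-1}$.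 $\mathbb V$ is the space of $V_h$-valued functions on $(0,T)$ that are constant on each $I_n$. $\mathbb V_1$ (resp. $\mathbb V_2$) is the space of functions $[0,T]\to V_h$, defined at every point, whose restriction to $(0,T)$ is in $\mathbb V$ and that are right-continuous at $t_0,\dots,t_{N-1}$ (resp. left-continuous at $t_1,\dots,t_N$). Temporal jumps: $(|w|)_n=w(t_n^-)-w(t_n^+)$ for $1\le n\le N-1$, $(|w|)_0=w(0)-w(0^+)$, $(|w|)_N=w(T^-)-w(T)$. The reconstructions are the continuous, piecewise affine-in-time functions $(\mathcal I_1w)(t)=w(t)-\frac{t-t_{n-1}}{\tau_n}(|w|)_n$ for $t\in[t_{n-1},t_n)$, $w\in\mathbb V_1$, and $(\mathcal I_2w)(t)=w(t)+\frac{t_n-t}{\tau_n}(|w|)_{n-1}$ for $t\in(t_{n-1},t_n]$, $w\in\mathbb V_2$, $n\in\{1,\dots,N\}$ (with $(\mathcal I_1w)(T)=w(T)$, $(\mathcal I_2w)(0)=w(0)$). *)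

(* Defs.v *)
From HB Require Import structures.
From mathcomp Require Import all_boot all_order all_algebra finmap.
From mathcomp Require Import all_classical all_reals all_analysis.
Set Implicit Arguments.
Unset Strict Implicit.
Unset Printing Implicit Defensive.
Import Order.TTheory GRing.Theory Num.Theory.
Import numFieldNormedType.Exports.
Local Open Scope classical_set_scope.
Local Open Scope ring_scope.

(* Lebesgue measure on R^n: the library only has it for n = 1, so 'rV[R]_n
   gets the product sigma-algebra (that of the coordinate maps, as the library
   does for n.-tuple) and the measure is the n-fold product of the
   one-dimensional one. *)

Definition measure_rV_display : measure_display.
Proof. exact: default_measure_display. Qed.

Section measurable_rV.
Variables (R : realType) (n : nat).

Let coors : 'I_n -> 'rV[R]_n -> R := fun i x => x ord0 i.

Let rV_set0 : g_sigma_preimage coors set0.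
Proof. exact: sigma_algebra0. Qed.

Let rV_setC A : g_sigma_preimage coors A -> g_sigma_preimage coors (~` A).
Proof. exact: sigma_algebraC. Qed.

Let rV_bigcup (F : _^nat) : (forall i, g_sigma_preimage coors (F i)) ->
  g_sigma_preimage coors (\bigcup_i (F i)).
Proof. exact: sigma_algebra_bigcup. Qed.

HB.instance Definition _ := @isMeasurable.Build measure_rV_display
  'rV[R]_n (g_sigma_preimage coors) rV_set0 rV_setC rV_bigcup.

End measurable_rV.

Section leb.
Variable R : realType.

Lemma measurable_coor n (i : 'I_n) :
  measurable_fun [set: 'rV[R]_n] (fun x : 'rV[R]_n => x ord0 i).
Proof.
move=> _ Y mY; rewrite setTI; apply: sub_sigma_algebra => /=.
rewrite -bigcup_seq/=; exists i => /=; first by rewrite mem_index_enum.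
by exists Y => //; rewrite setTI.
Qed.

Lemma measurable_fun_coorP d (T : measurableType d) n (f : T -> 'rV[R]_n) :
  (forall i, measurable_fun [set: T] (fun t => f t ord0 i)) ->
  measurable_fun [set: T] f.
Proof.
move=> mf; pose C := fun (i : 'I_n) (x : 'rV[R]_n) => x ord0 i.
suff : g_sigma_preimage (fun i => C i \o f) `<=` measurable.
  rewrite g_sigma_preimage_comp => prefS _ A mA.
  by apply: prefS; exists A.
apply: smallest_sub; first exact: sigma_algebra_measurable.
case: n f mf @C => [|n] f mf C; first by rewrite big_ord0.
by rewrite -bigcup_mkord_ord; apply: bigcup_sub => i Ii A [B mB <-]; exact: mf.
Qed.

Definition rV_cons n (p : measurableTypeR R * 'rV[R]_n) : 'rV[R]_n.+1 :=
  \row_i if unlift ord0 i is Some j then p.2 ord0 j else p.1.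

Lemma measurable_rV_cons n : measurable_fun setT (@rV_cons n).
Proof.
apply: measurable_fun_coorP => i.
case: (unliftP ord0 i) => [j|] ->.
  rewrite (_ : (fun _ => _) = (fun x : 'rV[R]_n => x ord0 j) \o snd); last first.
    by apply/funext => p /=; rewrite mxE liftK.
  by apply: measurableT_comp => //; exact: measurable_coor.
rewrite (_ : (fun _ => _) = fst)//.
by apply/funext => p /=; rewrite mxE unlift_none.
Qed.

Definition leb_cons n (mu : set 'rV[R]_n -> \bar R) : set 'rV[R]_n.+1 -> \bar R :=
  pushforward (@lebesgue_measure R \x mu)%E (@rV_cons n).

Fixpoint leb n : set 'rV[R]_n -> \bar R :=
  if n is n'.+1 then leb_cons (@leb n') else \d_(0 : 'rV[R]_0).

Section leb_cons.
Variables (n : nat) (mu : {sigma_finite_measure set 'rV[R]_n -> \bar R}).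

Local Notation step := (leb_cons mu).

Let step0 : step set0 = 0%E.
Proof. by rewrite /leb_cons /pushforward preimage_set0 measure0. Qed.

Let step_ge0 A : (0 <= step A)%E.
Proof. by rewrite /leb_cons /pushforward; apply: measure_ge0. Qed.

Let step_sigma_additive : semi_sigma_additive step.
Proof.
have mcons A : measurable A -> measurable (@rV_cons n @^-1` A).
  by move=> mA; rewrite -[X in measurable X]setTI; exact: measurable_rV_cons.
move=> F mF tF mUF; rewrite /leb_cons /pushforward preimage_bigcup.
apply: measure_semi_sigma_additive.
- by move=> k; exact: mcons.
- apply/trivIsetP => /= i j _ _ ij; rewrite -preimage_setI.
  by move/trivIsetP : tF => /(_ _ _ _ _ ij) ->//; rewrite preimage_set0.
- by rewrite -preimage_bigcup; exact: mcons.
Qed.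

HB.instance Definition _ :=
  isMeasure.Build _ _ _ step step0 step_ge0 step_sigma_additive.

Let step_sigma_finite : sigma_finite setT step.
Proof.
have /sigma_finiteP[F [TF ndF Foo]] := sigma_finiteT (@lebesgue_measure R).
have /sigma_finiteP[G [TG ndG Goo]] := sigma_finiteT mu.
pose uncons (x : 'rV[R]_n.+1) : measurableTypeR R * 'rV[R]_n :=
  (x ord0 ord0, \row_j x ord0 (lift ord0 j)).
have muncons : measurable_fun setT uncons.
  apply/measurable_fun_pairP; split; first exact: measurable_coor.
  apply: measurable_fun_coorP => j; rewrite /uncons/=.
  under eq_fun do rewrite mxE.
  exact: measurable_coor.
have consK : cancel (@rV_cons n) uncons.
  move=> [a x]; congr pair; rewrite ?mxE ?unlift_none//.
  by apply/rowP => j; rewrite !mxE liftK.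
exists (fun k => uncons @^-1` (F k `*` G k)).
  rewrite -preimage_bigcup -[LHS](preimage_setT uncons); congr (_ @^-1` _).
  apply/seteqP; split=> // -[a x] _.
  have [k _ Fka] : (\bigcup_k F k) a by rewrite -TF.
  have [l _ Glx] : (\bigcup_k G k) x by rewrite -TG.
  exists (maxn k l) => //; split => /=.
  - by move: a Fka; exact/subsetPset/ndF/leq_maxl.
  - by move: x Glx; exact/subsetPset/ndG/leq_maxr.
move=> k; have [mF Fk] := Foo k; have [mG Gk] := Goo k; split.
  by rewrite -[X in measurable X]setTI; apply: muncons => //; exact: measurableX.
rewrite /leb_cons /pushforward -comp_preimage.
rewrite (_ : uncons \o @rV_cons n = id); last by apply/funext => p; exact: consK.
by rewrite preimage_id product_measure1E// lte_mul_pinfty// ge0_fin_numE.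
Qed.

HB.instance Definition _ :=
  Measure_isSigmaFinite.Build _ _ _ step step_sigma_finite.

End leb_cons.

Lemma leb_sigma_finite_measure n :
  exists mu : {sigma_finite_measure set 'rV[R]_n -> \bar R},
    leb (n := n) = mu :> (set _ -> \bar R).
Proof.
elim: n => [|n [mu muE]].
  by exists (\d_(0 : 'rV[R]_0) : {sigma_finite_measure set _ -> \bar R}).
by exists (leb_cons mu : {sigma_finite_measure set _ -> \bar R}); rewrite /= muE.
Qed.

Variable n : nat.

Let leb0 : leb (set0 : set 'rV[R]_n) = 0%E.
Proof. by have [mu ->] := leb_sigma_finite_measure n; rewrite measure0. Qed.

Let leb_ge0 (A : set 'rV[R]_n) : (0 <= leb A)%E.
Proof. by have [mu ->] := leb_sigma_finite_measure n; exact: measure_ge0. Qed.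

Let leb_sigma_additive : semi_sigma_additive (@leb n).
Proof.
have [mu ->] := leb_sigma_finite_measure n.
exact: measure_semi_sigma_additive.
Qed.

HB.instance Definition _ :=
  isMeasure.Build _ _ _ (@leb n) leb0 leb_ge0 leb_sigma_additive.

Let leb_sigma_finite : sigma_finite setT (@leb n).
Proof.
by have [mu ->] := leb_sigma_finite_measure n; exact: sigma_finiteT.
Qed.

HB.instance Definition _ :=
  Measure_isSigmaFinite.Build _ _ _ (@leb n) leb_sigma_finite.

End leb.
Arguments leb {R n}.

Section domain.
Variables (R : realType) (d : nat).
Local Notation E := 'rV[R]_d.
Implicit Types (Om : set E) (f v phi : E -> R) (g : E -> E).

(* The canonical norm of 'rV[R]_d is the sup norm; distances and gradients are
   measured with the Euclidean one below. *)
Definition dotp (x y : E) : R := \sum_(i < d) x ord0 i * y ord0 i.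
Definition enorm (x : E) : R := Num.sqrt (dotp x x).

(* Near x, Om lies strictly below the graph of a Lipschitz function over the
   hyperplane orthogonal to the unit vector e; gamma is that function, extended
   to R^d so as to be constant along e. *)
Definition lipschitz_boundary Om : Prop :=
  forall x, (closure Om `\` interior Om) x ->
  exists (e : E) (gamma : E -> R) (L r : R),
    [/\ enorm e = 1, 0 < r,
        forall y z, `|gamma y - gamma z| <= L * enorm (y - z),
        forall y s, gamma (y + s *: e) = gamma y &
        forall y, enorm (y - x) < r -> (Om y <-> dotp y e < gamma y)].

Definition lipschitz_domain Om : Prop :=
  [/\ open Om, connected Om, bounded_set Om & lipschitz_boundary Om].

Definition ip Om f1 f2 : R := \int[leb]_(x in Om) (f1 x * f2 x).

Definition L2 Om f : Prop :=
  measurable_fun Om f /\ (\int[leb]_(x in Om) ((f x) ^+ 2)%:E < +oo)%E.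

Definition partial (i : 'I_d) f : E -> R := 'D_(delta_mx ord0 i) f.

(* C^1_c(Om); test functions of class C^1 and of class C^oo define the same
   weak derivatives and the same space H^1_0. *)
Definition test_function Om phi : Prop :=
  [/\ forall x, differentiable phi x,
      forall i, continuous (partial i phi) &
      exists K : set E, [/\ compact K, K `<=` Om & forall x, ~ K x -> phi x = 0]].

Definition weak_gradient Om v g : Prop :=
  [/\ L2 Om v, forall i, L2 Om (fun x => g x ord0 i) &
      forall phi i, test_function Om phi ->
        ip Om v (partial i phi) = - ip Om (fun x => g x ord0 i) phi].

Definition H1 Om v : Prop := exists g, weak_gradient Om v g.

(* A representative; weak gradients are unique up to null sets. *)
Definition grad Om v : E -> E := xget (cst 0) [set g | weak_gradient Om v g].

Definition H1_sqnorm Om v : R :=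
  ip Om v v + \int[leb]_(x in Om) dotp (grad Om v x) (grad Om v x).

(* The closure of the test functions in H^1(Om). *)
Definition H1_0 Om v : Prop :=
  H1 Om v /\ forall eps, 0 < eps ->
    exists2 phi, test_function Om phi & H1_sqnorm Om (fun x => v x - phi x) < eps.

Definition grad_norm Om v : R :=
  Num.sqrt (\int[leb]_(x in Om) dotp (grad Om v x) (grad Om v x)).

End domain.

Section mesh.
Variables (R : realType) (d : nat).
Local Notation E := 'rV[R]_d.
Implicit Types (Om : set E) (K : {fset E}) (Th : {fset {fset E}}).

Definition affinely_independent K : Prop :=
  forall mu : E -> R, \sum_(z <- K) mu z = 0 -> \sum_(z <- K) mu z *: z = 0 ->
    forall z, z \in K -> mu z = 0.

Definition conv K : set E :=
  [set x | exists mu : E -> R,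
    [/\ forall z, z \in K -> 0 <= mu z, \sum_(z <- K) mu z = 1 &
        x = \sum_(z <- K) mu z *: z]].

(* Simplices are given by their vertex sets: the element K of the mesh Th
   stands for the closed simplex conv K.  As conv fset0 = set0, the last
   condition says that two elements are disjoint or share a common face. *)
Definition simplicial_mesh Om Th : Prop :=
  [/\ forall K, K \in Th -> #|` K| = d.+1 /\ affinely_independent K,
      \bigcup_(K in [set` Th]) conv K = closure Om &
      forall K K', K \in Th -> K' \in Th ->
        exists F : {fset E},
          [/\ {subset F <= K}, {subset F <= K'} & conv K `&` conv K' = conv F]].

Definition hdiam K : R :=
  sup [set r | exists x y, [/\ conv K x, conv K y & r = enorm (x - y)]].

Definition vertices Th : {fset E} := (\bigcup_(K <- Th) K)%fset.
Definition inner_vertices Om Th : {fset E} :=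
  [fset z in vertices Th | z \in Om]%fset.

(* An element of V_h is the everywhere defined function that is affine on every
   closed simplex, normalized to vanish outside the closure of Om. *)
Definition Vh Om Th : set (E -> R) :=
  [set v | [/\ H1_0 Om v,
    forall K, K \in Th -> exists (a : E) (b : R),
      forall x, conv K x -> v x = dotp a x + b &
    forall x, ~ closure Om x -> v x = 0]].

(* phi z is the hat function of z, equal to 1 at z and to 0 at all the other
   vertices (linear independence follows). *)
Definition nodal_basis Om Th (phi : E -> E -> R) : Prop :=
  [/\ forall z, z \in inner_vertices Om Th -> Vh Om Th (phi z),
      forall z z', z \in inner_vertices Om Th -> z' \in vertices Th ->
        phi z z' = (z == z')%:R &
      forall v, Vh Om Th v -> exists c : E -> R,
        forall x, v x = \sum_(z <- inner_vertices Om Th) c z * phi z x].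

Definition lumped_ip Om Th (phi : E -> E -> R) (v w : E -> R) : R :=
  \sum_(z <- inner_vertices Om Th) ip Om (phi z) (cst 1) * v z * w z.

End mesh.

Section time.
Variables (R : realType) (d : nat).
Local Notation E := 'rV[R]_d.
Variables (N : nat) (tn : nat -> R).
Implicit Types (V : set (E -> R)) (v w : R -> E -> R).

Definition time_partition (T : R) : Prop :=
  [/\ tn 0%N = 0, tn N = T & forall n, (n < N)%N -> tn n < tn n.+1].

(* The n-th interval of the list I_1, ..., I_N is ]tn n.-1, tn n[; below it is
   indexed by its left end point, 0 <= n < N. *)
Definition tau n : R := tn n.+1 - tn n.

(* Only the values of w on ]tn 0, tn N[ matter. *)
Definition VV V w : Prop :=
  (forall t, t \in `]tn 0%N, tn N[ -> V (w t)) /\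
  (forall n s t, (n < N)%N -> s \in `]tn n, tn n.+1[ -> t \in `]tn n, tn n.+1[ ->
     w s = w t).

(* w is not zero in L^2(0,T; V_h): its values at the nodes are irrelevant. *)
Definition VV_nonzero w : Prop :=
  exists n t, [/\ (n < N)%N, t \in `]tn n, tn n.+1[ & w t <> cst 0].

(* V_h is finite dimensional, so that one-sided limits in time can be taken
   pointwise in space. *)
Definition VV1 V v : Prop :=
  [/\ forall t, t \in `[tn 0%N, tn N] -> V (v t), VV V v &
      forall n x, (n < N)%N -> v s x @[s --> (tn n)^'+] --> v (tn n) x].

Definition VV2 V v : Prop :=
  [/\ forall t, t \in `[tn 0%N, tn N] -> V (v t), VV V v &
      forall n x, (0 < n <= N)%N -> v s x @[s --> (tn n)^'-] --> v (tn n) x].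

Definition jump w n : E -> R := fun x =>
  (if n == 0%N then w (tn n) x else lim (w s x @[s --> (tn n)^'-])) -
  (if n == N then w (tn n) x else lim (w s x @[s --> (tn n)^'+])).

(* The intervals [tn n, tn n.+1[ (resp. ]tn n, tn n.+1]) partition [0, T[
   (resp. ]0, T]), so at most one term of the sum is nonzero. *)
Definition I1 w : R -> E -> R := fun t x =>
  w t x - \sum_(n < N)
    \1_(`[tn n, tn n.+1[%classic) t * ((t - tn n) / tau n) * jump w n.+1 x.

Definition I2 w : R -> E -> R := fun t x =>
  w t x + \sum_(n < N)
    \1_(`]tn n, tn n.+1]%classic) t * ((tn n.+1 - t) / tau n) * jump w n x.

Definition Dt v : R -> E -> R := fun t x => derive1 (fun s => v s x) t.

Definition X_norm (Om : set E) (T : R) w : R :=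
  Num.sqrt (\int[lebesgue_measure]_(t in `]0, T[) (grad_norm Om (w t)) ^+ 2).

(* The dual norm of the mass lumping error of u, u = Dt (I_i v). *)
Definition lumping_error Om Th (phi : E -> E -> R) (T : R) (u : R -> E -> R)
    : \bar R :=
  ereal_sup [set ((\int[lebesgue_measure]_(t in `]0%R, T[)
      (ip Om (u t) (w t) - lumped_ip Om Th phi (u t) (w t)))
      / X_norm Om T w)%:E
    | w in [set w | VV (Vh Om Th) w /\ VV_nonzero w]].

End time.

(* Main.v *)
Require Import Defs.
From HB Require Import structures.
From mathcomp Require Import all_boot all_order all_algebra finmap.
From mathcomp Require Import all_classical all_reals all_analysis.
From mathcomp Require Import measurable_realfun ring lra.
Import Defs.
Set Implicit Arguments.
Unset Strict Implicit.
Unset Printing Implicit Defensive.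
Import Order.TTheory GRing.Theory Num.Theory.
Import numFieldNormedType.Exports.
Local Open Scope classical_set_scope.
Local Open Scope ring_scope.

(** The argument is pointwise in space. On a simplex with vertices z the hat
    functions are the barycentric coordinates m_z, so for affine u, w
      sum_z m_z u(z) w(z) - u w = 1/2 sum_{z,z'} m_z m_z' (u(z)-u(z')) (w(z)-w(z')),
    which is at most h_K^2 |grad u| |grad w| / 2, with no dependence on the
    dimension. Integrating over the domain bounds the mass lumping error of u, w
    by max h_K^2 |u|_{H^1} |w|_{H^1} / 2. In time, d/dt (I_i v) = - J_n / tau_n on I_n,
    with J_n the relevant jump, while v - I_i v is J_n times a ramp whose
    square has integral tau_n / 3; since h_K^2 <= tau_n / C_TJ, Cauchy-Schwarz
    gives the estimate with C = 1 / C_TJ.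

    The gradients in the norms are arbitrary weak gradients. To identify them
    almost everywhere with the slopes of the affine pieces one tests with
    products of one-dimensional C^1 cutoffs, and uses that almost every point of
    the domain is interior to a simplex, faces lying in null hyperplanes. *)

(** * Lebesgue measure on row vectors *)

(** Integral forms of Cauchy-Schwarz are replaced by Young's inequality with a free parameter [s]:
    the bound [s * p ^+ 2 + q ^+ 2 / s] is linear in the energies, so it passes through integrals
    and sums, and [s] is chosen only at the very end. The factor 1/4 in the spatial estimate is the
    1/2 of the covariance identity times the 1/2 of Young. With A the norm of [v - I_i v] and B that
    of the test function, the final bound is [CTJ^-1 / 4 * (3 * s * A ^+ 2 + B ^+ 2 / s)], the 3
    undoing the ramp's 1/3; [s = B / A] turns it into [CTJ^-1 * (A * B)]. The optimal [s] would gain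
    a factor sqrt 3 / 2; the simpler one avoids roots. [grad] picks a weak gradient by choice, so
    even the gradient of [c * f] has no pointwise relation to that of [f]; the slopes of the affine
    pieces are the common reference. That discrete functions vanish at the boundary vertices is read
    off the nodal basis, which avoids any trace theorem. *)

Section lebesgue.
Variable R : realType.
Local Notation mu1 := (@lebesgue_measure R).

Lemma measurable_prod_coor n (f : 'I_n -> R -> R) :
  (forall i, measurable_fun setT (f i)) ->
  measurable_fun setT (fun x : 'rV[R]_n => \prod_i f i (x ord0 i)).
Proof.
move=> mf; apply: measurable_prod => i _.
by apply: measurableT_comp => //; exact: measurable_coor.
Qed.

Lemma rV_consE n (p : measurableTypeR R * 'rV[R]_n) :
  (rV_cons p ord0 ord0 = p.1) * (forall j, rV_cons p ord0 (lift ord0 j) = p.2 ord0 j).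
Proof. by split=> [|j]; rewrite mxE ?unlift_none ?liftK. Qed.

(** The measure in dimension [n.+1] is by definition the push-forward of a product measure under
    [rV_cons], so this is a change of variables; it prepares the use of Fubini. *)
Lemma integral_leb_succ n (f : 'rV[R]_n.+1 -> \bar R) : measurable_fun [set: 'rV[R]_n.+1] f ->
  (mu1 \x @leb R n)%E.-integrable setT (f \o @rV_cons R n) ->
  (@leb R n.+1).-integrable setT f /\
  (\int[@leb R n.+1]_x f x = \int[(mu1 \x @leb R n)%E]_p f (rV_cons p))%E.
Proof.
move=> mf intf; split.
  have := @integrable_pushforward _ _ _ _ R _ (@measurable_rV_cons R n)
    (mu1 \x @leb R n)%E setT f mf intf measurableT.
  by move=> /integrableP[_ h]; apply/integrableP; split => //.
have := @integral_pushforward _ _ _ _ R _ (@measurable_rV_cons R n)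
  (mu1 \x @leb R n)%E setT f mf intf measurableT.
by rewrite preimage_setT => <-.
Qed.

(** Induction on the dimension, splitting off the first coordinate. Integrability is part of the
    conclusion because Fubini needs it for the remaining coordinates. *)
Lemma integral_prod_coor n (f : 'I_n -> R -> R) :
  (forall i, mu1.-integrable setT (EFin \o f i)) ->
  leb.-integrable setT (fun x : 'rV[R]_n => (\prod_i f i (x ord0 i))%:E) /\
  \int[leb]_x \prod_i f i (x ord0 i) = \prod_i \int[mu1]_t f i t.
Proof.
elim: n f => [|n IH] f intf.
  under eq_fun do rewrite big_ord0; rewrite big_ord0.
  (* In dimension 0 the measure is a Dirac mass and the product is empty, so both sides are 1. *)
  have leb0T : @leb R 0 setT = 1%E by exact: diracT.
  split; last by under eq_Rintegral do rewrite big_ord0; rewrite Rintegral_cst// mul1r;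
    exact: (congr1 fine leb0T).
  apply/integrableP; split => //.
  under eq_integral do rewrite /= normr1; rewrite integral_cst// mul1e.
  exact: (eq_ind_r (fun z => (z < +oo)%E) (ltry 1) leb0T).
have mf i : measurable_fun setT (f i) by have /measurable_int/measurable_EFinP := intf i.
have [IHint IHE] := IH (fun j => f (lift ord0 j)) (fun j => intf _).
pose g (x : 'rV[R]_n) := \prod_j f (lift ord0 j) (x ord0 j).
have E x : \prod_i f i (rV_cons x ord0 i) = f ord0 x.1 * g x.2.
  by rewrite big_ord_recl rV_consE; congr (_ * _); apply: eq_bigr => j _; rewrite rV_consE.
have mg : measurable_fun setT g := measurable_prod_coor (fun j => mf (lift ord0 j)).
have mfg : measurable_fun setT (fun x : R * 'rV[R]_n => (f ord0 x.1 * g x.2)%:E).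
  apply/measurable_EFinP/measurable_funM.
    exact: (measurableT_comp (mf ord0) measurable_fst).
  exact: (measurableT_comp mg measurable_snd).
have intfg : (mu1 \x @leb R n)%E.-integrable setT
    (fun x : R * 'rV[R]_n => (f ord0 x.1 * g x.2)%:E).
  (* Tonelli: the iterated integral of the absolute value is a product of two finite numbers. *)
  apply/integrable12ltyP => //=.
  under eq_integral => x _.
    under eq_integral do rewrite normrM EFinM.
    rewrite ge0_integralZl//; last first.
      by apply/measurable_EFinP; apply: measurableT_comp.
    over.
  move: (intf ord0) IHint => /integrableP[_ /= h1] /integrableP[_ /= h2].
  rewrite ge0_integralZr//=.
  - by apply: lte_mul_pinfty => //; [exact: integral_ge0|rewrite ge0_fin_numE// integral_ge0].
  - by apply/measurable_EFinP; apply: measurableT_comp => //; exact: (mf ord0).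
  - by apply: integral_ge0.
have Ecomp : (fun x : 'rV[R]_n.+1 => (\prod_i f i (x ord0 i))%:E) \o @rV_cons R n
    = fun x => (f ord0 x.1 * g x.2)%:E by apply/funext => x /=; rewrite E.
have [h1 h2] := @integral_leb_succ n (fun x : 'rV[R]_n.+1 => (\prod_i f i (x ord0 i))%:E)
  ltac:(by apply/measurable_EFinP; exact: measurable_prod_coor) ltac:(by rewrite Ecomp).
split=> //.
rewrite /Rintegral h2.
under eq_integral do rewrite E.
rewrite -integral12_prod_meas1//= /fubini_F/=.
under eq_integral => x _.
  under eq_integral do rewrite EFinM.
  rewrite integralZl//.
  rewrite -(fineK (integrable_fin_num _ IHint))//.
  over.
rewrite integralZr//; last exact: intf.
rewrite fineM//; last exact: integrable_fin_num (intf ord0).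
by rewrite big_ord_recl -IHE.
Qed.

End lebesgue.

(** * Boxes, open sets and hyperplanes *)

Section boxes.
Variable R : realType.
Local Notation mu1 := (@lebesgue_measure R).

Definition box n (l r : 'rV[R]_n) : set 'rV[R]_n :=
  [set x | forall i, l ord0 i < x ord0 i < r ord0 i].

Lemma measurable_box n (l r : 'rV[R]_n) : measurable (box l r).
Proof.
rewrite (_ : box l r = \bigcap_(i in [set: 'I_n])
    ((fun x : 'rV[R]_n => x ord0 i) @^-1` `]l ord0 i, r ord0 i[)); last first.
  apply/seteqP; split=> x /= h i; first by move=> _; rewrite /= in_itv/=; exact: h.
  by have := h i Logic.I; rewrite /= in_itv.
apply: fin_bigcap_measurable => // i _.
by rewrite -[X in measurable X]setTI; apply: measurable_coor.
Qed.

(** The boxes are cubes with rational centre and half-width [k.+1%:R^-1], numbered by [pickle]; [P]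
    keeps those contained in [U]. *)
Lemma open_bigcup_box n (U : set 'rV[R]_n) : open U ->
  exists (P : set nat) (l r : nat -> 'rV[R]_n), U = \bigcup_(m in P) box (l m) (r m).
Proof.
move=> Uo.
pose lq (p : 'rV[rat]_n * nat) : 'rV[R]_n := \row_i (ratr (p.1 ord0 i) - p.2.+1%:R^-1).
pose rq (p : 'rV[rat]_n * nat) : 'rV[R]_n := \row_i (ratr (p.1 ord0 i) + p.2.+1%:R^-1).
(* Numbers that code nothing decode to a default cube, harmless since [P] tests inclusion in [U]. *)
pose dec m := odflt (0, 0%N) (choice.unpickle m : option ('rV[rat]_n * nat)).
exists [set m | box (lq (dec m)) (rq (dec m)) `<=` U], (lq \o dec), (rq \o dec).
apply/seteqP; split => [x Ux|x [m /= mU]]; last exact: mU.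
have /nbhs_ballP[e /= e0 exU] : nbhs x U by exact: open_nbhs_nbhs.
(* With half-width below [e / 2], a cube that contains [x] stays within sup distance [e] of it. *)
pose k := Num.truncn (2 / e).
have ke : k.+1%:R^-1 < e / 2 :> R.
  by rewrite -[e / 2]invrK ltf_pV2 ?posrE ?invr_gt0 ?divr_gt0// invf_div truncnS_gt.
have d0 : 0 < k.+1%:R^-1 :> R by rewrite invr_gt0.
have /choice[q qP] : forall i, exists q : rat,
    x ord0 i - k.+1%:R^-1 < ratr q < x ord0 i + k.+1%:R^-1.
  move: (k.+1%:R^-1 : R) d0 => d d0 i.
  have /rat_in_itvoo[q] : x ord0 i - d < x ord0 i + d by lra.
  by rewrite in_itv/=; exists q.
have dE : dec (choice.pickle (\row_i q i, k)) = (\row_i q i, k) by rewrite /dec choice.pickleK.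
exists (choice.pickle (\row_i q i, k)); rewrite /= dE /lq /rq/= => {dE}.
  move: (k.+1%:R^-1 : R) ke qP d0 => d ke qP d0 y yb.
  apply: exU; rewrite /ball/=; split => // a i; rewrite (ord1 a).
  have := yb i; rewrite !mxE/= => /andP[h1 h2].
  have /andP[h3 h4] := qP i; rewrite /ball/= ltr_norml; apply/andP; split; lra.
move: (k.+1%:R^-1 : R) qP => d qP i; rewrite !mxE/=.
have /andP[h3 h4] := qP i; apply/andP; split; lra.
Qed.

Lemma measurable_open n (U : set 'rV[R]_n) : open U -> measurable U.
Proof.
move=> /open_bigcup_box[P [l [r ->]]].
by apply: bigcup_measurable => k _; exact: measurable_box.
Qed.

(** The indicator of a box is the product of the indicators of its sides, which are integrable. *)
Lemma leb_box_lty n (l r : 'rV[R]_n) : (leb (box l r) < +oo)%E.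
Proof.
have h i : mu1.-integrable setT (EFin \o (\1_`]l ord0 i, r ord0 i[ : R -> R)).
  apply/integrableP; split; first exact/measurable_EFinP/measurable_indic.
  under eq_integral do rewrite /= ger0_norm//.
  rewrite integral_indic// setIT /= lebesgue_measure_itv/=.
  by case: ifP => _; rewrite ltry.
have [/integrable_lty + _] := integral_prod_coor h.
move=> /(_ measurableT) hfin; apply: le_lt_trans hfin.
rewrite le_eqVlt; apply/orP; left; apply/eqP.
rewrite -[X in leb X]setIT -integral_indic//; last exact: measurable_box.
apply: eq_integral => x _; congr (_%:E); rewrite indicE.
have [|] := boolP (x \in box l r).
  rewrite inE => bx; rewrite /=; apply/esym; apply: big1 => i _; rewrite indicE mem_set//=.
  by rewrite in_itv/= bx.
move=> /negP xb; apply/esym/eqP/negPn/negP => /prodf_neq0 h0; apply: xb; rewrite inE => i.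
have := h0 i isT; rewrite indicE pnatr_eq0 eqb0 negbK inE/= in_itv/=.
by [].
Qed.

Lemma leb_bounded_lty n (U : set 'rV[R]_n) :
  measurable U -> bounded_set U -> (leb U < +oo)%E.
Proof.
move=> mU [M [_ MU]].
(* [bounded_set] bounds the norm by every number above [M], here [M + 1]; the extra 1 makes room for
   the strict inequalities of the box. *)
apply: le_lt_trans (leb_box_lty (const_mx (- (M + 2))) (const_mx (M + 2))).
apply: le_measure; rewrite ?inE//; first exact: measurable_box.
move=> x /(MU (M + 1)) h i; rewrite !mxE -ltr_norml.
apply: (@le_lt_trans _ _ `|x|); last first.
  by apply: le_lt_trans (h _) _; rewrite ?ltrD2l ?ltr1n// ltrDl.
rewrite [leRHS]/Num.norm /= mx_normrE; apply/bigmax_geP; right => /=.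
by exists (ord0, i).
Qed.

Lemma measurable_dotp n (c : 'rV[R]_n) :
  measurable_fun [set: 'rV[R]_n] (fun x => dotp c x).
Proof.
apply: measurable_sum => i.
by apply: measurable_funM => //; exact: measurable_coor.
Qed.

(** Slice along the first coordinate. If [c] has another nonzero entry, every slice is a hyperplane
    of lower dimension; otherwise the slices are empty except for a single abscissa. *)
Lemma leb_hyperplane n (c : 'rV[R]_n) (b : R) : c != 0 ->
  leb [set x | dotp c x + b = 0] = 0%E.
Proof.
elim: n c b => [|n IH] c b c0.
  by case/eqP: c0; apply/rowP; case.
pose c' := \row_j c ord0 (lift ord0 j).
set A := [set x | _].
have mA : measurable A.
  rewrite (_ : A = (fun x => dotp c x + b) @^-1` [set 0])//.
  rewrite -[X in measurable X]setTI.
  by apply: (measurable_funD (measurable_dotp c) (measurable_cst b)) => //.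
have mB : measurable (@rV_cons R n @^-1` A).
  by rewrite -[X in measurable X]setTI; apply: measurable_rV_cons.
have DE s y : dotp c (rV_cons (s, y)) + b = dotp c' y + (c ord0 ord0 * s + b).
  rewrite /dotp big_ord_recl rV_consE/= addrAC addrC; congr (_ + _).
  by apply: eq_bigr => i _; rewrite rV_consE mxE.
have BE s : xsection (@rV_cons R n @^-1` A) s
    = [set y | dotp c' y + (c ord0 ord0 * s + b) = 0].
  by apply/seteqP; split=> y; rewrite /xsection/= inE /A/= DE.
have -> : leb A = (\int[mu1]_s leb (xsection (@rV_cons R n @^-1` A) s))%E by [].
have [c'0|c'0] := eqVneq c' 0; last first.
  by apply: integral0_eq => s _; rewrite BE; exact: IH.
have a0 : c ord0 ord0 != 0.
  apply: contra_neq c0 => a0; apply/rowP => i; rewrite mxE.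
  case: (unliftP ord0 i) => [j|] ->//.
  by move/rowP/(_ j): c'0; rewrite !mxE.
rewrite (ae_eq_integral (cst 0%E))//=; first by rewrite integral0.
  exact: (@measurable_fun_xsection _ _ _ _ R (@leb R n) _ mB).
exists [set - b / c ord0 ord0]; split => //; first exact: lebesgue_measure_set1.
move=> s /= h; apply: contrapT => sb; apply: h => _.
rewrite BE (_ : [set _ | _] = set0) ?measure0//.
apply/seteqP; split => // y /=; rewrite c'0.
rewrite (_ : dotp 0 y = 0) ?add0r; last first.
  by apply: big1 => i _; rewrite mxE mul0r.
move=> /eqP; rewrite addr_eq0 => /eqP e; apply: sb.
by rewrite -e mulrC mulKf.
Qed.

End boxes.

(** * Test functions on boxes *)

Section cutoff.
Variable R : realType.
Local Notation mu1 := (@lebesgue_measure R).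

(** The squared positive part is C^1 with an explicit derivative. Test functions are only required
    to be C^1, so compositions of it with polynomials serve as cutoffs, without exponentials. *)
Definition posq (y : R) : R := Num.max 0 y ^+ 2.

Lemma posq_ge0 y : 0 <= posq y. Proof. exact: sqr_ge0. Qed.

(** A quadratic bound on the remainder treats the kink of the positive part like any other point. *)
Lemma is_derive_of_sqr_error (f : R -> R) (x a : R) :
  (forall h, `|f (h + x) - f x - a * h| <= h ^+ 2) -> is_derive x 1 f a.
Proof.
move=> fh.
have H : h^-1 *: ((f \o shift x) (h *: (1 : R)) - f x) @[h --> 0^'] --> a.
  apply/cvgrPdist_le => e e0; near=> h.
  have h0 : h != 0 by near: h; exact: nbhs_dnbhs_neq.
  have he : `|h| <= e by near: h; apply: dnbhs0_le.
  rewrite /= /shift [h *: 1]mulr1.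
  have -> : a - h^-1 *: (f (h + x) - f x) = - (f (h + x) - f x - a * h) / h.
    by rewrite /GRing.scale/=; field.
  rewrite normrM normrN normfV ler_pdivrMr ?normr_gt0//.
  apply: le_trans (fh h) _.
  by rewrite -real_normK ?num_real// expr2 ler_wpM2r.
apply: DeriveDef; first by apply/cvg_ex; exists a.
exact: cvg_lim H.
Unshelve. all: by end_near. Qed.

Lemma is_derive_posq (x : R) : is_derive x 1 posq (2 * Num.max 0 x).
Proof.
apply: is_derive_of_sqr_error => h; rewrite /posq ler_norml.
by case: (leP 0 x) => x0; case: (leP 0 (h + x)) => hx0; apply/andP; split; nra.
Qed.

Lemma continuous_max0 : continuous (fun x : R => Num.max 0 x).
Proof. by move=> x; apply: continuous_max; [exact: cvg_cst|exact: cvg_id]. Qed.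

Variables l r : R.

(* C^1, with [cutoff k t = 0] where [k (t - l) (r - t) <= 1] and [cutoff k t = 1] where
   [k (t - l) (r - t) >= 2]. *)
Definition cutoff (k : nat) (t : R) : R :=
  1 - posq (1 - posq (k%:R * ((t - l) * (r - t)) - 1)).

Definition dcutoff (k : nat) (t : R) : R :=
  2 * Num.max 0 (1 - posq (k%:R * ((t - l) * (r - t)) - 1)) *
  (2 * Num.max 0 (k%:R * ((t - l) * (r - t)) - 1)) * (k%:R * (l + r - 2 * t)).

Lemma is_derive_cutoff k (t : R) : is_derive t 1 (cutoff k) (dcutoff k t).
Proof.
have h1 : is_derive t 1 (fun t => k%:R * ((t - l) * (r - t)) - 1) (k%:R * (l + r - 2 * t)).
  apply: is_derive_eq.
  rewrite /GRing.scale/=; ring.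
have h2 := @is_derive1_comp R posq _ t _ _ (is_derive_posq _) h1.
have h3 := is_deriveB (is_derive_cst (1 : R) t (1 : R)) h2; rewrite sub0r in h3.
have h4 := @is_derive1_comp R posq _ t _ _ (is_derive_posq _) h3.
have h5 := is_deriveB (is_derive_cst (1 : R) t (1 : R)) h4; rewrite sub0r in h5.
rewrite (_ : dcutoff k t =
  - (2 * Num.max 0 (1 - posq (k%:R * ((t - l) * (r - t)) - 1)) *
     - (2 * Num.max 0 (k%:R * ((t - l) * (r - t)) - 1) * (k%:R * (l + r - 2 * t)))))//.
by rewrite /dcutoff; ring.
Qed.

Lemma continuous_dcutoff k : continuous (dcutoff k).
Proof.
have c1 : continuous (fun t : R => k%:R * ((t - l) * (r - t)) - 1).
  move=> t; apply: cvgB; last exact: cvg_cst.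
  apply: cvgM; first exact: cvg_cst.
  by apply: cvgM; apply: cvgB; (exact: cvg_cst || exact: cvg_id).
have c2 : continuous (fun t : R => Num.max 0 (k%:R * ((t - l) * (r - t)) - 1)).
  by move=> t; apply: (continuous_comp (@c1 t)); exact: continuous_max0.
have c3 : continuous (fun t : R => 1 - posq (k%:R * ((t - l) * (r - t)) - 1)).
  by move=> t; apply: cvgB; [exact: cvg_cst|apply: cvgM; exact: c2].
move=> t; apply: cvgM.
  apply: cvgM; last by apply: cvgM; [exact: cvg_cst|exact: c2].
  apply: cvgM; first exact: cvg_cst.
  by apply: (continuous_comp (@c3 t)); exact: continuous_max0.
apply: cvgM; first exact: cvg_cst.
by apply: cvgB; [exact: cvg_cst|apply: cvgM; [exact: cvg_cst|exact: cvg_id]].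
Qed.

Lemma continuous_cutoff k : continuous (cutoff k).
Proof.
by move=> t; apply/differentiable_continuous/derivable1_diffP; case: (is_derive_cutoff k t).
Qed.

(** A compact set containing the support. The interval is imposed separately because for [r < l] the
    inequality can also hold between [r] and [l]. *)
Definition cutoff_supp k : set R := [set t | l <= t <= r /\ 1 <= k%:R * ((t - l) * (r - t))].

Lemma cutoff_supp_compact k : compact (cutoff_supp k).
Proof.
rewrite (_ : cutoff_supp k = `[l, r] `&`
    (fun t => k%:R * ((t - l) * (r - t))) @^-1` [set x | 1 <= x]); last first.
  by apply/seteqP; split => t /=; rewrite in_itv/=.
apply: (subclosed_compact _ (@segment_compact _ l r)); last by move=> t [].
apply: closedI; first exact: itv_closed.
apply: closed_comp; last exact: closed_ge.
move=> t _; apply: cvgM; first exact: cvg_cst.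
by apply: cvgM; apply: cvgB; (exact: cvg_cst || exact: cvg_id).
Qed.

Lemma cutoff_suppS k t : cutoff_supp k t -> l < t < r.
Proof.
move=> [/andP[lt tr] h]; rewrite !lt_neqAle lt tr !andbT.
by apply/andP; split; apply/eqP => e; move: h; rewrite e subrr ?(mul0r,mulr0) ler10.
Qed.

Hypothesis lr : l <= r.

Lemma cutoff_arg k t : ~ cutoff_supp k t -> k%:R * ((t - l) * (r - t)) - 1 <= 0.
Proof.
move=> h; rewrite subr_le0 leNgt; apply/negP => h1; apply: h; split; last exact: ltW.
have h2 : 0 < (t - l) * (r - t).
  rewrite ltNge; apply/negP => h2; move: h1; rewrite ltNge => /negP; apply.
  by apply: (@le_trans _ _ 0) => //; rewrite mulr_ge0_le0.
case: (leP l t) => lt; case: (leP t r) => tr //=; exfalso.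
- by move: h2; rewrite ltNge mulr_ge0_le0//; lra.
- by move: h2; rewrite ltNge mulr_le0_ge0//; lra.
- by have := lt_trans tr lt; rewrite ltNge lr.
Qed.

Lemma cutoff0 k t : ~ cutoff_supp k t -> cutoff k t = 0.
Proof.
move=> /cutoff_arg h; rewrite /cutoff /posq (max_l h).
by rewrite expr0n/= subr0 max_r// expr1n subrr.
Qed.

Lemma dcutoff0 k t : ~ cutoff_supp k t -> dcutoff k t = 0.
Proof. by move=> /cutoff_arg h; rewrite /dcutoff /posq (max_l h) mulr0 mulr0 mul0r. Qed.

Lemma cutoff_ge0_le1 k t : 0 <= cutoff k t <= 1.
Proof.
rewrite /cutoff gerBl posq_ge0 andbT subr_ge0 /posq.
rewrite expr_le1//; last by rewrite le_max lexx.
by rewrite ge_max ler01/= gerBl sqr_ge0.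
Qed.

Lemma cvg_cutoff t : l < t < r -> cutoff k t @[k --> \oo] --> (1 : R).
Proof.
move=> /andP[lt tr].
have p0 : 0 < (t - l) * (r - t) by rewrite mulr_gt0 ?subr_gt0.
apply: cvg_near_cst; near=> k.
(* From 2 on, the inner [posq] is at least 1, so the outer one vanishes: the sequence is eventually
   constant. *)
have kp : 2 <= k%:R * ((t - l) * (r - t)).
  rewrite -ler_pdivrMr//; near: k; exact: nbhs_infty_ger.
have h : 1 - posq (k%:R * ((t - l) * (r - t)) - 1) <= 0.
  rewrite subr_le0 /posq max_r; last lra.
  rewrite expr_ge1//; lra.
by rewrite /cutoff {1}/posq max_l// expr0n subr0.
Unshelve. all: by end_near. Qed.

End cutoff.

(** * One-dimensional integrals of the cutoffs *)

Section cutoff_integrals.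
Variable R : realType.
Local Notation mu1 := (@lebesgue_measure R).

Lemma integrable_continuous_supp (f : R -> R) (l r : R) : continuous f ->
  (forall t, ~ (l <= t <= r) -> f t = 0) -> mu1.-integrable setT (EFin \o f).
Proof.
move=> cf f0.
have -> : EFin \o f = (EFin \o f) \_ `[l, r].
  apply/funext => t; rewrite patchE; case: ifPn => //.
  rewrite notin_setE /= in_itv/= => h.
  by rewrite f0.
have h : mu1.-integrable `[l, r] (EFin \o f).
  apply: continuous_compact_integrable; first exact: segment_compact.
  exact: continuous_subspaceT.
exact: ((@integrable_mkcond _ _ R mu1 _ (EFin \o f) (measurable_itv `[l, r])).1 h).
Qed.

Lemma Rintegral_derive_supp (F f : R -> R) (l r : R) : l < r ->
  (forall t : R, is_derive t 1 F (f t)) -> continuous f -> F l = F r ->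
  (forall t, ~ (l <= t <= r) -> f t = 0) -> \int[mu1]_t f t = 0.
Proof.
move=> lr Ff cf Flr f0.
have cF : continuous F.
  by move=> t; apply/differentiable_continuous/derivable1_diffP; case: (Ff t).
have -> : \int[mu1]_t f t = \int[mu1]_(t in `[l, r]) f t.
  rewrite [RHS]Rintegral_mkcond; apply: eq_Rintegral => t _.
  rewrite patchE; case: ifPn => //; rewrite notin_setE /= in_itv/= => h.
  by rewrite f0.
rewrite /Rintegral (@continuous_FTC2 _ f F)//= ?Flr ?subrr//.
- exact: continuous_subspaceT.
- split; first by move=> t _; case: (Ff t).
  + by apply: cvg_at_right_filter; exact: cF.
  + by apply: cvg_at_left_filter; exact: cF.
- by move=> t _; rewrite derive1E; case: (Ff t).
Qed.

Variables (l r : R) (k : nat).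
Hypothesis lr : l < r.
Local Notation b := (cutoff l r k).
Local Notation db := (dcutoff l r k).

Lemma cutoff_out t : ~ (l <= t <= r) -> b t = 0.
Proof. by move=> h; apply: cutoff0 => [|[]//]; exact: ltW. Qed.

Lemma dcutoff_out t : ~ (l <= t <= r) -> db t = 0.
Proof. by move=> h; apply: dcutoff0 => [|[]//]; exact: ltW. Qed.

Lemma cutoff_lr : b l = b r.
Proof.
by rewrite !cutoff0 ?ltW//; move=> /cutoff_suppS; rewrite ltxx ?andbF.
Qed.

Lemma integrable_cutoff : mu1.-integrable setT (EFin \o b).
Proof. exact: integrable_continuous_supp (@continuous_cutoff _ l r k) cutoff_out. Qed.

Lemma integrable_mulid (f : R -> R) : continuous f ->
  (forall t, ~ (l <= t <= r) -> f t = 0) ->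
  mu1.-integrable setT (EFin \o (fun t => t * f t)).
Proof.
move=> cf f0; apply: (@integrable_continuous_supp _ l r).
  by move=> t; apply: cvgM; [exact: cvg_id|exact: cf].
by move=> t /f0 ->; rewrite mulr0.
Qed.

Lemma Rintegral_dcutoff : \int[mu1]_t db t = 0.
Proof.
by apply: (Rintegral_derive_supp lr (is_derive_cutoff l r k) (@continuous_dcutoff _ l r k)
  cutoff_lr dcutoff_out).
Qed.

(** Integration by parts: [t * b t] is a primitive of the sum of the two integrands and vanishes at
    both ends. *)
Lemma Rintegral_mulid_dcutoff : \int[mu1]_t (t * db t) = - \int[mu1]_t b t.
Proof.
apply/eqP; rewrite -addr_eq0; apply/eqP.
rewrite -RintegralD//; last exact: integrable_cutoff; last first.
  exact: integrable_mulid (@continuous_dcutoff _ l r k) dcutoff_out.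
apply: (@Rintegral_derive_supp (fun t => t * b t) _ _ _ lr).
- move=> t; have := is_deriveM (is_derive_id t (1 : R)) (is_derive_cutoff l r k t).
  by rewrite /GRing.scale/= mulr1.
- move=> t; apply: cvgD; last exact: continuous_cutoff.
  by apply: cvgM; [exact: cvg_id|exact: continuous_dcutoff].
- have h u : (u == l) || (u == r) -> b u = 0.
    by move=> /orP[] /eqP ->; rewrite cutoff0 ?ltW//; move=> /cutoff_suppS; rewrite ltxx ?andbF.
  by rewrite !h ?eqxx ?orbT// !mulr0.
- by move=> t h; rewrite dcutoff_out// cutoff_out// mulr0 addr0.
Qed.

End cutoff_integrals.

Lemma Rintegral_sum d (T : measurableType d) (R : realType)
    (mu : {measure set T -> \bar R}) (D : set T) (I : eqType) (s : seq I)
    (f : I -> T -> R) : measurable D ->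
  (forall i, i \in s -> mu.-integrable D (EFin \o f i)) ->
  mu.-integrable D (EFin \o (fun x => \sum_(i <- s) f i x)) /\
  \int[mu]_(x in D) (\sum_(i <- s) f i x) = \sum_(i <- s) \int[mu]_(x in D) f i x.
Proof.
move=> mD; elim: s => [_|i s IH intf].
  have -> : (fun x => \sum_(i <- [::]) f i x) = cst 0.
    by apply/funext => x; rewrite big_nil.
  by rewrite big_nil Rintegral_cst// mul0r; split=> //; exact: integrable0.
have intfi : mu.-integrable D (EFin \o f i) by apply: intf; rewrite mem_head.
have [intfs fsE] := IH (fun j js => intf j (mem_behead (s := i :: s) js)).
have -> : (fun x => \sum_(j <- i :: s) f j x) = (fun x => f i x + \sum_(j <- s) f j x).
  by apply/funext => x; rewrite big_cons.
by rewrite RintegralD// big_cons fsE; split=> //;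
  have := integrableD mD intfi intfs; apply: eq_integrable.
Qed.

(** * Products of functions of one coordinate *)

Section prod_coor.
Variables (R : realType) (n : nat).
Local Notation mu1 := (@lebesgue_measure R).
Local Notation E := 'rV[R]_n.

Definition prod_coor (f : 'I_n -> R -> R) (x : E) : R := \prod_j f j (x ord0 j).

Lemma continuous_prod_coor f : (forall j, continuous (f j)) -> continuous (prod_coor f).
Proof.
move=> cf; suff H s : continuous (fun y : E => \prod_(j <- s) f j (y ord0 j)) by exact: H.
elim: s => [|j s IH].
  have -> : (fun y : E => \prod_(j <- [::]) f j (y ord0 j)) = cst 1.
    by apply/funext => y; rewrite big_nil.
  exact: cst_continuous.
have -> : (fun y : E => \prod_(j <- j :: s) f j (y ord0 j)) =
    (fun y : E => f j (y ord0 j) * \prod_(j <- s) f j (y ord0 j)).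
  by apply/funext => y; rewrite big_cons.
move=> x; apply: (@continuousM _ _ (fun y : E => f j (y ord0 j))); last exact: IH.
by apply: (continuous_comp (@coord_continuous _ _ _ ord0 j x)); exact: cf.
Qed.

Lemma differentiable_prod_coor f : (forall j t, derivable (f j) t (1 : R)) ->
  forall x, differentiable (prod_coor f) x.
Proof.
move=> df x; suff H s : differentiable (fun y : E => \prod_(j <- s) f j (y ord0 j)) x by exact: H.
elim: s => [|j s IH].
  have -> : (fun y : E => \prod_(j <- [::]) f j (y ord0 j)) = cst 1.
    by apply/funext => y; rewrite big_nil.
  exact: differentiable_cst.
have -> : (fun y : E => \prod_(j <- j :: s) f j (y ord0 j)) =
    (fun y : E => f j (y ord0 j)) * (fun y : E => \prod_(j <- s) f j (y ord0 j)).
  by apply/funext => y; rewrite big_cons.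
apply: differentiableM => //.
apply: (@differentiable_comp _ _ _ _ (fun y : E => y ord0 j) (f j)).
  exact: differentiable_coord.
exact/derivable1_diffP.
Qed.

(** Along the [i]-th basis vector the other factors do not change, so the difference quotient of the
    product is exactly that of [f i] times a constant. *)
Lemma partial_prod_coor (f df : 'I_n -> R -> R) i :
  (forall j (t : R), is_derive t (1 : R) (f j) (df j t)) ->
  partial i (prod_coor f) = prod_coor (fun j => if j == i then df j else f j).
Proof.
move=> fdf; apply/funext => x; rewrite /partial/=.
have [dfi dfE] := fdf i (x ord0 i).
pose c := \prod_(j | j != i) f j (x ord0 j).
rewrite {2}/prod_coor (bigD1 i)//= eqxx.
rewrite (eq_bigr (fun j => f j (x ord0 j))); last by move=> j /negPf ->.
apply: cvg_lim => //.
have -> : (fun h : R =>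
    h^-1 *: ((prod_coor f \o shift x) (h *: (delta_mx ord0 i : E)) - prod_coor f x))
  = (fun h => (h^-1 *: ((f i \o shift (x ord0 i)) (h *: (1 : R)) - f i (x ord0 i))) * c).
  apply/funext => h; rewrite -scalerAl; congr (_ *: _).
  rewrite mulrBl; congr (_ - _).
    rewrite /prod_coor/= (bigD1 i)//= !mxE !eqxx/= mulr1; congr (_ * _).
      by rewrite /shift [h *: 1]mulr1.
    by apply: eq_bigr => j ji; rewrite !mxE/= (negPf ji) mulr0 add0r.
  by rewrite /prod_coor (bigD1 i).
by apply: cvgM; [rewrite -dfE; exact: dfi|exact: cvg_cst].
Qed.

Lemma continuous_if_eq (f g : 'I_n -> R -> R) i :
  (forall j, continuous (f j)) -> (forall j, continuous (g j)) ->
  forall j, continuous (if j == i then f j else g j).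
Proof. by move=> cf cg j; case: ifP. Qed.

End prod_coor.

Section box_cutoff.
Variables (R : realType) (n : nat).
Local Notation mu1 := (@lebesgue_measure R).
Local Notation E := 'rV[R]_n.
Variables (l r : E) (k : nat).
Hypothesis lr : forall i, l ord0 i < r ord0 i.

Let f j := cutoff (l ord0 j) (r ord0 j) k.
Let df j := dcutoff (l ord0 j) (r ord0 j) k.

Definition box_cutoff : E -> R := prod_coor f.

Lemma partial_box_cutoff i : partial i box_cutoff =
  prod_coor (fun j => if j == i then df j else f j).
Proof. by apply: partial_prod_coor => j t; exact: is_derive_cutoff. Qed.

Lemma box_cutoff_out x : ~ box l r x -> box_cutoff x = 0.
Proof.
move=> bx; apply/eqP/negPn/negP => /prodf_neq0 h; apply: bx => i.
have := h i isT; apply: contra_neqT => hi; apply: cutoff0; first exact: ltW.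
by move=> /cutoff_suppS; apply/negP.
Qed.

Lemma partial_box_cutoff_out i x : ~ box l r x -> partial i box_cutoff x = 0.
Proof.
rewrite partial_box_cutoff.
move=> bx; apply/eqP/negPn/negP => /prodf_neq0 h; apply: bx => j.
have := h j isT; apply: contra_neqT => hi.
have hs : ~ cutoff_supp (l ord0 j) (r ord0 j) k (x ord0 j).
  by move=> /cutoff_suppS; apply/negP.
by case: ifP => _; [apply: dcutoff0|apply: cutoff0] => //; exact: ltW.
Qed.

Lemma test_function_box_cutoff Om : box l r `<=` Om -> test_function Om box_cutoff.
Proof.
move=> bOm; split.
- by apply: differentiable_prod_coor => j t; case: (is_derive_cutoff (l ord0 j) (r ord0 j) k t).
- move=> i; rewrite partial_box_cutoff; apply: continuous_prod_coor.
  by apply: continuous_if_eq => j; [exact: continuous_dcutoff|exact: continuous_cutoff].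
- exists [set x : E | forall i, cutoff_supp (l ord0 i) (r ord0 i) k (x ord0 i)]; split.
  + apply: (@rV_compact R n (fun i => cutoff_supp (l ord0 i) (r ord0 i) k)) => i.
    exact: cutoff_supp_compact.
  + by move=> x h; apply: bOm => i; exact: cutoff_suppS (h i).
  + move=> x h; apply/eqP/negPn/negP => /prodf_neq0 h'; apply: h => i.
    have := h' i isT; apply: contra_neqP => hi; apply: cutoff0 => //; exact: ltW.
Qed.

Lemma box_cutoff_ge0_le1 x : 0 <= box_cutoff x <= 1.
Proof.
have h j : 0 <= f j (x ord0 j) <= 1 by exact: cutoff_ge0_le1.
rewrite /box_cutoff /prod_coor prodr_ge0/=; last by move=> j _; case/andP: (h j).
by rewrite prodr_ile1// => j _; exact: h.
Qed.

(** The linear factor is absorbed into the [m]-th function, which keeps the product form and hence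
    the factorization of the integral. *)
Lemma integrable_prod_coor_mulid (g : 'I_n -> R -> R) m :
  (forall j, continuous (g j)) ->
  (forall j t, ~ (l ord0 j <= t <= r ord0 j) -> g j t = 0) ->
  leb.-integrable setT (fun x : E => (x ord0 m * prod_coor g x)%:E) /\
  \int[leb]_x (x ord0 m * prod_coor g x) =
  (\int[mu1]_t (t * g m t)) * \prod_(j | j != m) \int[mu1]_t g j t.
Proof.
move=> cg g0.
pose h j := if j == m then (fun t => t * g j t) else g j.
have hE (x : E) : x ord0 m * prod_coor g x = prod_coor h x.
  rewrite /prod_coor (bigD1 m)//= [RHS](bigD1 m)//= /h eqxx mulrA; congr (_ * _).
  by apply: eq_bigr => j /negPf ->.
have ih j : mu1.-integrable setT (EFin \o h j).
  rewrite /h; case: ifP => _; first exact: integrable_mulid (cg j) (g0 j).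
  exact: integrable_continuous_supp (cg j) (g0 j).
have [h1 h2] := integral_prod_coor ih.
split; first by under eq_fun do rewrite hE.
under eq_Rintegral do rewrite hE.
rewrite h2 (bigD1 m)//= /h eqxx; congr (_ * _).
by apply: eq_bigr => j /negPf ->.
Qed.

Lemma integrable_prod_coor_supp (g : 'I_n -> R -> R) :
  (forall j, continuous (g j)) ->
  (forall j t, ~ (l ord0 j <= t <= r ord0 j) -> g j t = 0) ->
  leb.-integrable setT (fun x : E => (prod_coor g x)%:E) /\
  \int[leb]_x (prod_coor g x) = \prod_j \int[mu1]_t g j t.
Proof.
move=> cg g0; apply: integral_prod_coor => j.
exact: integrable_continuous_supp (cg j) (g0 j).
Qed.

(* Each term factors into one-dimensional integrals, among which int f' = 0, except
   for the i-th one, where int t f'(t) dt = - int f. *)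
Lemma integral_affine_partial_box_cutoff a b i :
  \int[leb]_x ((dotp a x + b) * partial i box_cutoff x) =
  - (a ord0 i * \int[leb]_x box_cutoff x).
Proof.
rewrite partial_box_cutoff; set g := fun j => if j == i then _ else _.
have cg j : continuous (g j).
  by apply: continuous_if_eq => j'; [exact: continuous_dcutoff|exact: continuous_cutoff].
have g0 j t : ~ (l ord0 j <= t <= r ord0 j) -> g j t = 0.
  by rewrite /g; case: ifP => _; [exact: dcutoff_out|exact: cutoff_out].
have gi : \int[mu1]_t g i t = 0 by rewrite /g eqxx; exact: Rintegral_dcutoff.
have [ig igE] := integrable_prod_coor_supp cg g0.
have igm m := (integrable_prod_coor_mulid m cg g0).1.
have igmE m := (integrable_prod_coor_mulid m cg g0).2.
have E0 (x : E) : (dotp a x + b) * prod_coor g x =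
    \sum_m a ord0 m * (x ord0 m * prod_coor g x) + b * prod_coor g x.
  by rewrite mulrDl /dotp mulr_suml; congr (_ + _); apply: eq_bigr => m _; rewrite mulrA.
under eq_Rintegral do rewrite E0.
have igm' m : leb.-integrable setT (fun x : E => (a ord0 m * (x ord0 m * prod_coor g x))%:E).
  by under eq_fun do rewrite EFinM; apply: integrableZl.
rewrite RintegralD//; first last.
- rewrite (_ : EFin \o _ = fun x : E => (b%:E * (prod_coor g x)%:E)%E)//.
  exact: integrableZl.
- rewrite (_ : EFin \o _ = fun x : E =>
    (\sum_m (a ord0 m * (x ord0 m * prod_coor g x))%:E)%E); first exact: integrable_sum.
  by apply/funext => x; rewrite /= sumEFin.
rewrite RintegralZl// igE [X in _ + b * X](bigD1 i)//= gi mul0r mulr0 addr0.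
have [_ ->] := Rintegral_sum (s := index_enum 'I_n) measurableT (fun m _ => igm' m).
rewrite (bigD1 i)//= [X in _ + X]big1 ?addr0; last first.
  move=> m mi; rewrite RintegralZl//; last exact: igm.
  rewrite (igmE m) (bigD1 i)//= ?gi ?mul0r ?mulr0//.
  by rewrite eq_sym.
rewrite RintegralZl//; last exact: igm.
rewrite (igmE i) /g eqxx Rintegral_mulid_dcutoff// mulNr mulrN.
rewrite (integrable_prod_coor_supp _ _).2; first last.
- by move=> j; exact: cutoff_out.
- by move=> j; exact: continuous_cutoff.
rewrite [in RHS](bigD1 i)//=; congr (- (_ * (_ * _))).
by apply: eq_bigr => j /negPf ->.
Qed.

End box_cutoff.

(** * Weak gradients of functions affine on a box *)

Section orthants.
Variables (R : realType) (n : nat).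
Local Notation E := 'rV[R]_n.

(** Upper orthants form a generating family stable under intersection, as Dynkin's theorem requires,
    and they cut a box into a box with the same upper corner. *)
Definition orthant (l : E) : set E := [set x | forall i, l ord0 i < x ord0 i].

Lemma measurable_orthant l : measurable (orthant l).
Proof.
rewrite (_ : orthant l = \bigcap_(i in [set: 'I_n])
    ((fun x : E => x ord0 i) @^-1` `]l ord0 i, +oo[)); last first.
  apply/seteqP; split=> x /= h i; first by move=> _; rewrite /= in_itv/= andbT; exact: h.
  by have := h i Logic.I; rewrite /= in_itv/= andbT.
apply: fin_bigcap_measurable => // i _.
by rewrite -[X in measurable X]setTI; apply: measurable_coor.
Qed.

Lemma orthantI : setI_closed (range orthant).
Proof.
move=> _ _ [l _ <-] [l' _ <-]; exists (\row_i Num.max (l ord0 i) (l' ord0 i)) => //.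
apply/seteqP; split=> x /= h.
  by split=> i; have := h i; rewrite mxE gt_max => /andP[].
by move=> i; rewrite mxE gt_max h.1 h.2.
Qed.

Lemma measurable_rVE : @measurable _ E = <<s range orthant>>.
Proof.
rewrite eqEsubset; split; last first.
  apply: smallest_sub; first exact: sigma_algebra_measurable.
  by move=> _ [l _ <-]; exact: measurable_orthant.
apply: smallest_sub; first exact: smallest_sigma_algebra.
have H (i : 'I_n) : preimage_set_system setT (fun x : E => x ord0 i) measurable
    `<=` <<s range orthant>>.
  rewrite [X in preimage_set_system _ _ X](_ : _ = (@RGenOInfty.G R).-sigma.-measurable); last first.
    exact: RGenOInfty.measurableE.
  rewrite -g_sigma_preimageE; apply: smallest_sub; first exact: smallest_sigma_algebra.
  move=> _ [_ [x ->] <-].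
  (* A half-space is the union over [k] of the orthants whose other corner coordinates equal
     [- k]. *)
  pose l (k : nat) : E := \row_j if j == i then x else - k%:R.
  rewrite (_ : _ `&` _ = \bigcup_k orthant (l k)).
    by apply: sigma_algebra_bigcup => k; apply: sub_sigma_algebra; exists (l k).
  apply/seteqP; split=> y.
    move=> [_ /=]; rewrite in_itv/= andbT => xy.
    exists (Num.truncn (\sum_j `|y ord0 j|)).+1 => // j; rewrite mxE; case: eqP => [->//|_].
    rewrite ltrNl; apply: le_lt_trans (ler_norm _) _; rewrite normrN.
    apply: le_lt_trans (truncnS_gt _); rewrite (bigD1 j)//= lerDl.
    by apply: sumr_ge0.
  by move=> [k _ /(_ i)]; rewrite mxE eqxx /= in_itv/= andbT.
by elim/big_ind : _ => [|A B hA hB|i _]; [exact: sub0set|rewrite subUset|exact: H].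
Qed.

End orthants.

(** * A fundamental lemma of the calculus of variations on boxes *)

Section fundamental_lemma.
Variables (R : realType) (n : nat).
Local Notation E := 'rV[R]_n.

Lemma box_orthant (l r l' : E) :
  box l r `&` orthant l' = box (\row_i Num.max (l ord0 i) (l' ord0 i)) r.
Proof.
apply/seteqP; split=> x /=.
  by move=> [h1 h2] i; rewrite mxE gt_max h2 andbT; exact: h1.
move=> h; split=> i; have := h i; rewrite mxE gt_max => /andP[/andP[]] //.
by move=> -> _ ->.
Qed.

(** Boxes with upper corner [r] suffice: they are the traces of the orthants on the given box. By
    Dynkin's theorem the integral of [f] vanishes on every measurable part of the box. *)
Lemma ae_eq0_box (l r : E) (f : E -> R) :
  leb.-integrable (box l r) (EFin \o f) ->
  (forall l' : E, box l' r `<=` box l r -> \int[leb]_(x in box l' r) f x = 0) ->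
  {ae leb, forall x, box l r x -> f x = 0}.
Proof.
move=> intf f0; have mB := measurable_box l r.
have intA A : measurable A -> leb.-integrable (box l r `&` A) (EFin \o f).
  by move=> mA; apply: integrableS intf => //; exact: measurableI.
have H A : measurable A -> (\int[leb]_(x in box l r `&` A) (f x)%:E = 0)%E.
  move=> mA; have : <<s range (@orthant R n)>> A by rewrite -measurable_rVE.
  have tot : (\int[leb]_(x in box l r) (f x)%:E = 0)%E.
    rewrite -[LHS]fineK ?integrable_fin_num//.
    by congr (_%:E); apply: f0.
  move: A {mA}; apply: dynkin_induction; [exact: measurable_rVE|exact: orthantI|..].
  - by rewrite setIT.
  - move=> _ [l' _ <-]; have := intA _ (measurable_orthant l').
    rewrite box_orthant => h; rewrite -[LHS]fineK ?integrable_fin_num//; last exact: measurable_box.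
    by congr (_%:E); apply: f0; rewrite -box_orthant; exact: subIsetl.
  - move=> S mS S0.
    have := @integral_setU _ _ _ (@leb R n) (box l r `&` S) (box l r `&` ~` S) (EFin \o f).
    rewrite -setIUr setUv setIT tot /= S0 add0e => <- //.
    + exact: measurableI.
    + by apply: measurableI => //; exact: measurableC.
    + exact: measurable_int intf.
    + by apply/disj_setPS => x [[_ +] [_]].
  - move=> F mF tF F0; rewrite setI_bigcupr integral_bigcup//.
    + by apply: eseries0 => k _ _; exact: F0.
    + exact: trivIset_setIl.
    + by move=> k; exact: measurableI.
    + by rewrite -setI_bigcupr; apply: intA; exact: bigcup_measurable.
have := @integral_ae_eq _ _ _ leb _ mB (cst 0%E) (EFin \o f) intf (measurable_cst _).
case=> [A AB mA|N [mN N0 hN]].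
  rewrite integral0; have <- : box l r `&` A = A by apply/setIidr.
  exact: H.
exists N; split=> // x /= hx; apply: hN => /= h; apply: hx => bx.
by have [] := h bx.
Qed.

End fundamental_lemma.

Section weak_gradient_affine.
Variables (R : realType) (n : nat).
Local Notation E := 'rV[R]_n.

Lemma measurable_box_cutoff (l r : E) k : measurable_fun setT (box_cutoff l r k).
Proof.
apply: measurable_prod_coor => j.
by apply: continuous_measurable_fun; exact: continuous_cutoff.
Qed.

(** Dominated convergence: the cutoffs lie between 0 and 1 and tend to 1 at each point of the open
    box. *)
Lemma Rintegral_box_of_cutoffs (l r : E) (f : E -> R) :
  (forall i, l ord0 i < r ord0 i) ->
  leb.-integrable (box l r) (EFin \o f) ->
  (forall k, \int[leb]_(x in box l r) (f x * box_cutoff l r k x) = 0) ->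
  \int[leb]_(x in box l r) f x = 0.
Proof.
move=> lr intf f0; have mB := measurable_box l r.
have mf := measurable_int _ intf.
have mf' : measurable_fun (box l r) f by exact/measurable_EFinP.
have intk k : leb.-integrable (box l r) (fun x => (f x * box_cutoff l r k x)%:E).
  apply: (le_integrable mB _ _ intf).
    apply/measurable_EFinP; apply: measurable_funM => //.
    by apply: measurable_funTS; exact: measurable_box_cutoff.
  move=> x bx /=; rewrite lee_fin normrM ler_piMr//.
  by have /andP[h0 h1] := box_cutoff_ge0_le1 l r k x; rewrite ger0_norm.
have [] := @dominated_convergence _ _ _ (@leb R n) _ mB
  (fun k x => (f x * box_cutoff l r k x)%:E) (EFin \o f) (fun x => `|(f x)%:E|%E).
- by move=> k; exact: measurable_int (intk k).
- exact: mf.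
- apply: aeW => x bx; apply: cvg_EFin; first exact: nearW.
  rewrite [X in _ --> X](_ : _ = f x * 1); last by rewrite mulr1.
  apply: cvgM; first exact: cvg_cst.
  rewrite /box_cutoff /prod_coor.
  elim: (index_enum _) => [|j s IH].
    by under eq_fun do rewrite big_nil; exact: cvg_cst.
  under eq_fun do rewrite big_cons.
  have := cvgM (cvg_cutoff (bx j)) IH; rewrite mulr1; exact.
- exact: integrable_abse.
- apply: aeW => x k bx; rewrite abse_EFin lee_fin normrM ler_piMr//.
  by have /andP[h0 h1] := box_cutoff_ge0_le1 l r k x; rewrite ger0_norm.
move=> _ _ h.
have h0 : [sequence (\int[leb]_(x in box l r) (f x * box_cutoff l r k x)%:E)%E]_k = cst 0%E.
  apply/funext => k /=; rewrite -[LHS]fineK ?integrable_fin_num//.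
  by congr (_%:E); exact: f0.
rewrite h0 in h; rewrite /Rintegral.
have <- : 0%E = (\int[leb]_(x in box l r) (EFin \o f) x)%E; last by [].
by apply: cvg_unique h => //; exact: cvg_cst.
Qed.

Lemma integrable_leb_cst (D : set E) (c : R) : measurable D -> (leb D < +oo)%E ->
  leb.-integrable D (EFin \o cst c).
Proof.
move=> mD Doo; apply: measurable_bounded_integrable => //.
by exists `|c|; split => // M cM x _; exact: ltW.
Qed.

(** On a set of finite measure, since [|y| <= y ^+ 2 + 1]. *)
Lemma L2_integrable (D : set E) (f : E -> R) : measurable D -> (leb D < +oo)%E ->
  L2 D f -> leb.-integrable D (EFin \o f).
Proof.
move=> mD Doo [mf foo].
have i2 : leb.-integrable D (fun x => ((f x) ^+ 2)%:E).
  apply/integrableP; split; first by apply/measurable_EFinP; exact: measurable_funX.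
  by under eq_integral do rewrite abse_EFin ger0_norm ?sqr_ge0//.
have i1 : leb.-integrable D (EFin \o cst 1) by exact: integrable_leb_cst.
apply: (le_integrable mD _ _ (integrableD mD i2 i1)); first exact/measurable_EFinP.
move=> x Dx /=; rewrite lee_fin [leRHS]ger0_norm ?addr_ge0 ?sqr_ge0//.
by rewrite ler_norml; apply/andP; split; nra.
Qed.

(** Testing against the cutoffs of a sub-box, where the integral of the affine function times a
    partial derivative is explicit, shows that [g - a] is orthogonal to all of them, coordinate by
    coordinate; letting the cutoffs tend to 1 gives zero mean on each sub-box with upper corner
    [r]. *)
Lemma weak_gradient_affine (Om : set E) (v : E -> R) (g : E -> E) (l r a : E) (b : R) :
  measurable Om -> weak_gradient Om v g -> box l r `<=` Om ->
  (forall x, box l r x -> v x = dotp a x + b) ->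
  {ae leb, forall x, box l r x -> g x = a}.
Proof.
move=> mOm [vL2 gL2 gP] bOm va; have mB := measurable_box l r.
have ig i : leb.-integrable (box l r) (EFin \o (fun x => g x ord0 i)).
  apply: L2_integrable => //; first exact: leb_box_lty.
  have [mg goo] := gL2 i; split; first exact: measurable_funS mg.
  apply: le_lt_trans goo; apply: ge0_subset_integral => //.
    by apply/measurable_EFinP; exact: measurable_funX.
  by move=> x _; rewrite lee_fin sqr_ge0.
have ia i : leb.-integrable (box l r) (EFin \o cst (a ord0 i)).
  by apply: integrable_leb_cst => //; exact: leb_box_lty.
suff H i : {ae leb, forall x, box l r x -> g x ord0 i - a ord0 i = 0}.
  have : {ae leb, forall x i, box l r x -> g x ord0 i - a ord0 i = 0}.
    exact: filter_forall.
  apply: filterS => x h bx; apply/rowP => i.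
  by apply/eqP; rewrite -subr_eq0; apply/eqP; exact: h.
have iga : leb.-integrable (box l r) (EFin \o (fun x => g x ord0 i - a ord0 i)).
  by have := integrableB mB (ig i) (ia i); apply: eq_integrable.
apply: ae_eq0_box => // l' lB; have mB' := measurable_box l' r.
have [lr|] := pselect (forall j, l' ord0 j < r ord0 j); last first.
  (* A sub-box with a degenerate side is empty; the cutoffs used below need nondegenerate sides. *)
  move=> /existsNP[j /negP]; rewrite -leNgt => rl.
  rewrite (_ : box l' r = set0) ?Rintegral_set0//.
  apply/seteqP; split=> // x /(_ j) /andP[h1 h2].
  by have := lt_trans h1 h2; rewrite ltNge rl.
apply: Rintegral_box_of_cutoffs => //; first exact: integrableS iga.
move=> k; pose psi := box_cutoff l' r k.
have psiout x : ~ box l' r x -> psi x = 0 by exact: box_cutoff_out.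
have mpsi : measurable_fun (box l' r) psi.
  by apply: measurable_funTS; exact: measurable_box_cutoff.
have intpsi (f : E -> R) : leb.-integrable (box l' r) (EFin \o f) ->
    leb.-integrable (box l' r) (EFin \o (fun x => f x * psi x)).
  move=> fi; apply: (le_integrable mB' _ _ fi).
    apply/measurable_EFinP; apply: measurable_funM => //.
    by apply/measurable_EFinP; exact: measurable_int fi.
  move=> x bx /=; rewrite lee_fin normrM ler_piMr//.
  by have /andP[h0 h1] := box_cutoff_ge0_le1 l' r k x; rewrite ger0_norm.
(* [v] is given by its affine formula wherever the derivative of the cutoff is nonzero, so the
   integral over [Om] equals the explicit one over the whole space. *)
have E1 : ip Om v (partial i psi) = - (a ord0 i * \int[leb]_x psi x).
  rewrite -(integral_affine_partial_box_cutoff k lr a b) /ip Rintegral_mkcond.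
  apply: eq_Rintegral => x _; rewrite patchE.
  have [bx|bx] := pselect (box l' r x).
    by rewrite mem_set ?va//; [exact: lB|exact/bOm/lB].
  by case: ifPn => _; rewrite partial_box_cutoff_out// !mulr0.
have E2 : ip Om (fun x => g x ord0 i) psi = \int[leb]_(x in box l' r) (g x ord0 i * psi x).
  rewrite /ip Rintegral_mkcond [RHS]Rintegral_mkcond; apply: eq_Rintegral => x _; rewrite !patchE.
  have [bx|bx] := pselect (box l' r x).
    by rewrite !mem_set//; exact/bOm/lB.
  by rewrite [in RHS]memNset//; case: ifPn => _ //; rewrite psiout// mulr0.
have E3 : \int[leb]_x psi x = \int[leb]_(x in box l' r) psi x.
  rewrite [RHS]Rintegral_mkcond; apply: eq_Rintegral => x _; rewrite patchE.
  by case: ifPn => //; rewrite notin_setE => /psiout.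
have /eqP := gP psi i (test_function_box_cutoff k lr (subset_trans lB bOm)).
rewrite E1 E2 eqr_opp E3 => /eqP e.
under eq_Rintegral do rewrite mulrBl.
have ig' : leb.-integrable (box l' r) (EFin \o (fun x => g x ord0 i)) by exact: integrableS (ig i).
have ia' : leb.-integrable (box l' r) (EFin \o cst (a ord0 i)) by exact: integrableS (ia i).
rewrite RintegralB//; [|exact: intpsi ig'|exact: intpsi ia'].
rewrite RintegralZl ?e ?subrr//.
have := intpsi (cst 1) (integrable_leb_cst _ mB' (leb_box_lty _ _)).
by apply: eq_integrable => // x _ /=; rewrite mul1r.
Qed.

End weak_gradient_affine.

(** * Simplices *)

Section barycentric.
Variables (R : realType) (n : nat).
Local Notation E := 'rV[R]_n.
Variable K : {fset E}.
Hypothesis cardK : #|` K| = n.+1.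
Hypothesis indepK : affinely_independent K.

Let z (j : 'I_n.+1) : E := nth 0 (enum_fset K) j.

Let sizeK : size (enum_fset K) = n.+1. Proof. by rewrite -cardK. Qed.

Lemma vertex_in j : z j \in K.
Proof. by rewrite /z -[_ \in K]/(_ \in enum_fset K) mem_nth// sizeK. Qed.

Lemma sum_vertices (V : nmodType) (F : E -> V) : \sum_(x <- K) F x = \sum_j F (z j).
Proof. by rewrite (big_nth 0) sizeK big_mkord. Qed.

Let ind (x : E) : 'I_n.+1 := inord (index x (enum_fset K)).

Let zK j : ind (z j) = j.
Proof.
apply: val_inj; rewrite /= inordK; last first.
  by rewrite -sizeK index_mem; exact: vertex_in.
by rewrite index_uniq ?sizeK//; exact: fset_uniq.
Qed.

(** The rows are the vertices in homogeneous coordinates [(1, z j)]: multiplying by a row of weights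
    records both their sum and the weighted sum of the vertices, and affine independence becomes
    invertibility. *)
Definition bary_mx : 'M[R]_(n.+1, 1 + n) :=
  row_mx (const_mx 1) (\matrix_(j, i) z j ord0 i).

Lemma mul_bary_mx (u : 'rV[R]_n.+1) :
  u *m bary_mx = row_mx (\sum_j u ord0 j)%:M (\sum_j u ord0 j *: z j).
Proof.
rewrite mul_mx_row; congr row_mx; apply/rowP => i.
  rewrite !mxE (ord1 i) eqxx mulr1n; apply: eq_bigr => j _; rewrite mxE mulr1//.
by rewrite !mxE summxE; apply: eq_bigr => j _; rewrite !mxE.
Qed.

Lemma bary_mx_unit : (bary_mx : 'M[R]_n.+1) \in unitmx.
Proof.
rewrite -row_free_unit -kermx_eq0; apply/eqP/row_matrixP => i; rewrite row0.
set u := row i _.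
have : u *m bary_mx = 0 by apply/sub_kermxP; exact: row_sub.
rewrite mul_bary_mx -[in RHS]row_mx0 => /eq_row_mx[u1 u2].
(* Affine independence speaks of weights on points; [ind] turns the row [u], indexed by ordinals,
   into such a function. *)
have h := indepK (mu := fun x => u ord0 (ind x)).
apply/rowP => j; rewrite [in RHS]mxE -{1}(zK j); apply: h; last exact: vertex_in.
  rewrite sum_vertices; under eq_bigr do rewrite zK.
  by have := congr1 (fun A : 'M[R]_1 => A ord0 ord0) u1; rewrite !mxE eqxx mulr1n.
by rewrite sum_vertices; under eq_bigr do rewrite zK.
Qed.

Definition bary (x : E) : 'rV[R]_n.+1 := row_mx 1%:M x *m invmx (bary_mx : 'M[R]_n.+1).

Lemma bary_unique (u : 'rV[R]_n.+1) x :
  \sum_j u ord0 j = 1 -> x = \sum_j u ord0 j *: z j -> bary x = u.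
Proof.
move=> u1 ux; rewrite /bary -u1 ux -mul_bary_mx mulmxK//; exact: bary_mx_unit.
Qed.

Lemma baryP x : \sum_j bary x ord0 j = 1 /\ x = \sum_j bary x ord0 j *: z j.
Proof.
have : bary x *m bary_mx = row_mx 1%:M x by rewrite mulmxKV//; exact: bary_mx_unit.
rewrite mul_bary_mx => /eq_row_mx[u1 u2]; split=> //.
by have := congr1 (fun A : 'M[R]_1 => A ord0 ord0) u1; rewrite !mxE eqxx !mulr1n.
Qed.

Lemma conv_bary x : conv K x <-> forall j, 0 <= bary x ord0 j.
Proof.
split=> [[mu [mu0 mu1 xE]] j|h].
  rewrite (@bary_unique (\row_j mu (z j))).
  - by rewrite mxE; apply: mu0; exact: vertex_in.
  - by rewrite -mu1 sum_vertices; apply: eq_bigr => i _; rewrite mxE.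
  - by rewrite xE sum_vertices; apply: eq_bigr => i _; rewrite mxE.
have [b1 b2] := baryP x.
exists (fun y => bary x ord0 (ind y)); split=> //.
  by rewrite sum_vertices; under eq_bigr do rewrite zK.
by rewrite sum_vertices; under eq_bigr do rewrite zK.
Qed.

(** Slope of the [j]-th barycentric coordinate, read off column [j] of the inverse matrix; the first
    entry of that column is the constant term. *)
Let c j : E := \row_i (invmx (bary_mx : 'M[R]_n.+1)) (rshift 1 i) j.
Let b j : R := (invmx (bary_mx : 'M[R]_n.+1)) (@lshift 1 n ord0) j.

Lemma bary_affine x j : bary x ord0 j = dotp (c j) x + b j.
Proof.
rewrite mxE big_split_ord /= big_ord1 addrC; congr (_ + _).
  by apply: eq_bigr => i _; rewrite row_mxEr !mxE mulrC.
by rewrite row_mxEl mxE eqxx mul1r.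
Qed.

Lemma bary_vertex j k : bary (z k) ord0 j = (j == k)%:R.
Proof.
rewrite (@bary_unique (\row_j (j == k)%:R)) ?mxE//.
  by rewrite (bigD1 k)//= mxE eqxx big1 ?addr0// => i /negPf ik; rewrite mxE ik.
rewrite (bigD1 k)//= mxE eqxx scale1r big1 ?addr0// => i /negPf ik.
by rewrite mxE ik scale0r.
Qed.

(** The coordinate is 1 at its own vertex and 0 at another one; in positive dimension there is
    another one. *)
Lemma bary_slope_neq0 j : (0 < n)%N -> c j != 0.
Proof.
move=> n0; apply/eqP => c0.
have h k : bary (z k) ord0 j = b j.
  by rewrite bary_affine c0 /dotp big1 ?add0r// => i _; rewrite mxE mul0r.
have [k kj] : exists k : 'I_n.+1, j != k.
  by have [->|] := eqVneq j ord0; [exists (lift ord0 (Ordinal n0))|exists ord0].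
have := h j; rewrite -(h k) !bary_vertex eqxx (negPf kj) => /eqP.
by rewrite oner_eq0.
Qed.

Lemma continuous_dotp (a : E) : continuous (dotp a).
Proof.
suff H s : continuous (fun y : E => \sum_(j <- s) a ord0 j * y ord0 j) by exact: H.
elim: s => [|j s IH].
  have -> : (fun y : E => \sum_(j <- [::]) a ord0 j * y ord0 j) = cst 0.
    by apply/funext => y; rewrite big_nil.
  exact: cst_continuous.
have -> : (fun y : E => \sum_(j <- j :: s) a ord0 j * y ord0 j) =
    (fun y : E => a ord0 j * y ord0 j + \sum_(j <- s) a ord0 j * y ord0 j).
  by apply/funext => y; rewrite big_cons.
move=> x; apply: (@continuousD _ _ _ (fun y : E => a ord0 j * y ord0 j)); last exact: IH.
apply: (@continuousM _ _ (cst (a ord0 j)) (fun y : E => y ord0 j)); first exact: cst_continuous.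
exact: coord_continuous.
Qed.

(** Off the hyperplanes where some barycentric coordinate vanishes, a point of the simplex has
    strictly positive coordinates, and by continuity so do its neighbours. *)
Lemma ae_conv_interior : (0 < n)%N -> {ae leb, forall x, conv K x -> (conv K)^° x}.
Proof.
move=> n0.
have H j : {ae leb, forall x, bary x ord0 j <> 0}.
  exists [set x | dotp (c j) x + b j = 0]; split.
  - rewrite (_ : [set _ | _] = (fun x => dotp (c j) x + b j) @^-1` [set 0])//.
    rewrite -[X in measurable X]setTI.
    by apply: (measurable_funD (measurable_dotp (c j)) (measurable_cst (b j))).
  - by apply: leb_hyperplane; exact: bary_slope_neq0.
  - by move=> x /= /contrapT; rewrite bary_affine.
have : {ae leb, forall x j, bary x ord0 j <> 0} by exact: filter_forall.
apply: filterS => x hx /conv_bary cx.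
have : \forall y \near x, forall j, 0 < bary y ord0 j.
  have hf : Filter (nbhs x) by exact: nbhs_filter.
  apply: (filter_forall hf) => j.
  have cj : continuous (fun y => bary y ord0 j).
    rewrite (_ : (fun _ => _) = fun y => dotp (c j) y + b j); last first.
      by apply/funext => y; rewrite bary_affine.
    by move=> y; apply: continuousD; [exact: continuous_dotp|exact: cst_continuous].
  have o : nbhs (bary x ord0 j) [set t : R | 0 < t].
    apply: open_nbhs_nbhs; split; first exact: open_gt.
    by rewrite /= lt_neqAle cx andbT; apply/eqP => /esym; exact: hx.
  exact: cj x _ o.
by apply: filterS => y hy; apply/conv_bary => j; exact: ltW.
Qed.

End barycentric.

(** * Square-integrable functions and linearity of weak gradients *)

Section L2_theory.
Variables (R : realType) (n : nat).
Local Notation E := 'rV[R]_n.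

Lemma continuous_measurable_rV (D : set E) (f : E -> R) :
  continuous f -> measurable_fun D f.
Proof.
move=> cf; apply: (@measurable_funS _ _ _ _ setT) => //.
apply: (@measurability _ _ _ _ _ _ (@RGenOpens.G R)); first exact: RGenOpens.measurableE.
move=> _ [_ [a [b ->] <-]]; rewrite setTI; apply: measurable_open.
by apply: open_comp => [x _|]; [exact: cf|exact: itv_open].
Qed.

Implicit Types f g v w : E -> R.
Variable D : set E.
Hypothesis mD : measurable D.

Lemma L2_integrable_sqr f : L2 D f -> leb.-integrable D (EFin \o (fun x => f x ^+ 2)).
Proof.
move=> [mf foo]; apply/integrableP; split.
  by apply/measurable_EFinP; exact: measurable_funX.
by under eq_integral do rewrite /= ger0_norm ?sqr_ge0//.
Qed.

Lemma integrable_sqr_L2 f : measurable_fun D f ->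
  leb.-integrable D (EFin \o (fun x => f x ^+ 2)) -> L2 D f.
Proof.
move=> mf /integrableP[_ foo]; split=> //; apply: le_lt_trans foo.
by under [leRHS]eq_integral do rewrite /= ger0_norm ?sqr_ge0//.
Qed.

Lemma integrable_lin (f g : E -> R) (s t : R) : leb.-integrable D (EFin \o f) ->
  leb.-integrable D (EFin \o g) ->
  leb.-integrable D (EFin \o (fun x => s * f x + t * g x)).
Proof.
move=> fi gi; have := integrableD mD (integrableZl mD s fi) (integrableZl mD t gi).
by apply: eq_integrable.
Qed.

Lemma L2_lin f g (s t : R) : L2 D f -> L2 D g -> L2 D (fun x => s * f x + t * g x).
Proof.
move=> f2 g2; have [mf _] := f2; have [mg _] := g2.
have mfg : measurable_fun D (fun x => s * f x + t * g x).
  by apply: measurable_funD; exact: measurable_funM.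
apply: integrable_sqr_L2 => //.
apply: (le_integrable mD _ _ (integrable_lin (2 * s ^+ 2) (2 * t ^+ 2)
  (L2_integrable_sqr f2) (L2_integrable_sqr g2))).
  by apply/measurable_EFinP; exact: measurable_funX.
move=> x Dx; rewrite /= lee_fin ger0_norm ?sqr_ge0// ger0_norm.
  by have := sqr_ge0 (s * f x - t * g x); nra.
by have := sqr_ge0 (s * f x); have := sqr_ge0 (t * g x); rewrite !exprMn -!mulrA; lra.
Qed.

Lemma L2_integrable_mul f g : L2 D f -> L2 D g ->
  leb.-integrable D (EFin \o (fun x => f x * g x)).
Proof.
move=> f2 g2; have [mf _] := f2; have [mg _] := g2.
apply: (le_integrable mD _ _ (integrable_lin 1 1 (L2_integrable_sqr f2) (L2_integrable_sqr g2))).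
  by apply/measurable_EFinP; exact: measurable_funM.
move=> x Dx; rewrite /= lee_fin !mul1r [leRHS]ger0_norm ?addr_ge0 ?sqr_ge0//.
by rewrite ler_norml; apply/andP; split; nra.
Qed.

(** A bounded set lies in a compact cube, on which the square of [f] is bounded. *)
Lemma L2_continuous f : bounded_set D -> continuous f -> L2 D f.
Proof.
move=> bD cf; have Doo : (leb D < +oo)%E by exact: leb_bounded_lty.
have mf : measurable_fun D f by exact: continuous_measurable_rV.
apply: integrable_sqr_L2 => //; apply: measurable_bounded_integrable => //.
  exact: measurable_funX.
have [M [_ MD]] := bD.
pose B : set E := [set x | forall i, `[- (M + 1), M + 1]%classic (x ord0 i)].
have cB : compact B.
  by apply: (@rV_compact R n (fun=> `[- (M + 1), M + 1]%classic)) => i; exact: segment_compact.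
have c2 : continuous (fun x => f x ^+ 2) by move=> x; apply: continuousM; exact: cf.
have /compact_bounded[C [_ HC]] := continuous_compact (continuous_subspaceT c2) cB.
exists C; split; first exact: num_real.
move=> C' CC' x Dx; apply: HC => //; exists x => // i.
rewrite /= in_itv/= -ler_norml; apply: le_trans (MD (M + 1) _ x Dx); last by rewrite ltrDl.
rewrite [leRHS]/Num.norm /= mx_normrE; apply/bigmax_geP; right => /=.
by exists (ord0, i).
Qed.

(** Boundedness of [D] makes test functions and their partial derivatives square integrable, so that
    every pairing splits into integrable terms. *)
Lemma weak_gradient_lin v (g : E -> E) w (h : E -> E) (s t : R) : bounded_set D ->
  weak_gradient D v g -> weak_gradient D w h ->
  weak_gradient D (fun x => s * v x + t * w x) (fun x => s *: g x + t *: h x).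
Proof.
move=> bD [v2 g2 gP] [w2 h2 hP].
have E0 i : (fun x => (s *: g x + t *: h x) ord0 i) = fun x => s * g x ord0 i + t * h x ord0 i.
  by apply/funext => x; rewrite !mxE.
have ipD f1 f2 f3 : L2 D f1 -> L2 D f2 -> L2 D f3 ->
    ip D (fun x => s * f1 x + t * f2 x) f3 = s * ip D f1 f3 + t * ip D f2 f3.
  move=> L1 L2 L3; rewrite /ip.
  have i1 := L2_integrable_mul L1 L3; have i2 := L2_integrable_mul L2 L3.
  under eq_Rintegral do rewrite mulrDl -!mulrA.
  rewrite RintegralD// ?RintegralZl//.
  - by have := integrableZl mD s i1; apply: eq_integrable.
  - by have := integrableZl mD t i2; apply: eq_integrable.
split; first exact: L2_lin.
  by move=> i; rewrite E0; exact: L2_lin.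
move=> phi i tphi; have [dphi cphi _] := tphi.
rewrite E0 !ipD//.
- by rewrite gP// hP// !mulrN opprD.
- by apply: L2_continuous => // x; exact: differentiable_continuous.
- exact: L2_continuous.
Qed.

End L2_theory.

(** * The covariance identity, Young's inequality and Euclidean geometry *)

Section covariance.
Variables (R : realType) (I : Type).

(** Korkine's identity: for weights of total mass 1 the right-hand side is twice the covariance of
    [u] and [w]. *)
Lemma sum_covariance (s : seq I) (m u w : I -> R) :
  \sum_(i <- s) \sum_(j <- s) m i * m j * ((u i - u j) * (w i - w j)) =
  2 * ((\sum_(i <- s) m i * (u i * w i)) * (\sum_(i <- s) m i) -
       (\sum_(i <- s) m i * u i) * (\sum_(i <- s) m i * w i)).
Proof.
have E0 i j : m i * m j * ((u i - u j) * (w i - w j)) =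
  ((m i * (u i * w i)) * m j + m i * (m j * (u j * w j))) -
  ((m i * u i) * (m j * w j) + (m i * w i) * (m j * u j)) by ring.
under eq_bigr do under eq_bigr do rewrite E0.
under eq_bigr do rewrite big_split sumrN !big_split/=.
rewrite big_split sumrN !big_split/= -!big_distrlr/=; ring.
Qed.

Lemma young_norm (s p q : R) : 0 < s -> `|p * q| <= 2^-1 * (s * p ^+ 2 + q ^+ 2 / s).
Proof.
move=> s0; have h : s * p ^+ 2 + q ^+ 2 / s = s^-1 * ((s * p) ^+ 2 + q ^+ 2).
  by field; rewrite gt_eqF.
have sE : p * q = s^-1 * ((s * p) * q) by field; rewrite gt_eqF.
have si : 0 < s^-1 by rewrite invr_gt0.
rewrite h sE normrM gtr0_norm// mulrCA ler_pM2l//.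
move: (s * p) => r; have := sqr_ge0 (r - q); have := sqr_ge0 (r + q).
by rewrite ler_norml => h1 h2; apply/andP; split; lra.
Qed.

End covariance.

Section dotp.
Variables (R : realType) (n : nat).
Local Notation E := 'rV[R]_n.
Implicit Types a x y : E.

Lemma dotp_ge0 x : 0 <= dotp x x.
Proof. by apply: sumr_ge0 => i _; rewrite -expr2 sqr_ge0. Qed.

Lemma enorm_sqr x : enorm x ^+ 2 = dotp x x.
Proof. by rewrite sqr_sqrtr// dotp_ge0. Qed.

Lemma dotpDr a x y : dotp a (x + y) = dotp a x + dotp a y.
Proof. by rewrite -big_split; apply: eq_bigr => i _; rewrite mxE mulrDr. Qed.

Lemma dotpZr a k x : dotp a (k *: x) = k * dotp a x.
Proof. by rewrite mulr_sumr; apply: eq_bigr => i _; rewrite mxE mulrCA. Qed.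

Lemma dotpBr a x y : dotp a (x - y) = dotp a x - dotp a y.
Proof. by rewrite -scaleN1r dotpDr dotpZr mulN1r. Qed.

Lemma dotp_sumr (I : Type) (s : seq I) a (F : I -> E) :
  dotp a (\sum_(i <- s) F i) = \sum_(i <- s) dotp a (F i).
Proof.
elim: s => [|i s IH]; last by rewrite !big_cons dotpDr IH.
by rewrite !big_nil; apply: big1 => i _; rewrite mxE mulr0.
Qed.

(** The squared length of [(y.y) x - (x.y) y] is [y.y] times the gap in the inequality; the case
    [y.y = 0] is treated apart. *)
Lemma dotp_cauchy_schwarz x y : dotp x y ^+ 2 <= dotp x x * dotp y y.
Proof.
have h : 0 <= \sum_i (dotp y y * x ord0 i - dotp x y * y ord0 i) ^+ 2.
  by apply: sumr_ge0 => i _; exact: sqr_ge0.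
have {h} : 0 <= dotp y y * (dotp x x * dotp y y - dotp x y ^+ 2).
  apply: le_trans h _; rewrite le_eqVlt; apply/orP; left; apply/eqP.
  transitivity (\sum_i (dotp y y ^+ 2 * (x ord0 i * x ord0 i) -
      2 * dotp y y * dotp x y * (x ord0 i * y ord0 i) +
      dotp x y ^+ 2 * (y ord0 i * y ord0 i))).
    by apply: eq_bigr => i _; ring.
  rewrite big_split sumrB/= -!mulr_sumr -/(dotp x x) -/(dotp x y) -/(dotp y y); ring.
have := dotp_ge0 y; rewrite le_eqVlt => /predU1P[y0 _|y0]; last first.
  by rewrite pmulr_rge0// subr_ge0.
have yi i : y ord0 i = 0.
  move/esym/eqP: y0; rewrite psumr_eq0; last by move=> j _; rewrite -expr2 sqr_ge0.
  by move/allP/(_ i (mem_index_enum _)); rewrite mulf_eq0 orbb => /eqP.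
rewrite -y0 mulr0 (_ : dotp x y = 0) ?expr0n//.
by apply: big1 => i _; rewrite yi mulr0.
Qed.

End dotp.

Section simplex.
Variables (R : realType) (n : nat).
Local Notation E := 'rV[R]_n.
Implicit Types K : {fset E}.

Lemma conv_vertex K z : z \in K -> conv K z.
Proof.
move=> zK; exists (fun y => (y == z)%:R); split=> [y _||]; first exact: ler0n.
  rewrite (bigD1_seq z)//= eqxx big1 ?addr0// => y /negPf ->//.
rewrite (bigD1_seq z)//= eqxx scale1r big1 ?addr0// => y /negPf ->.
by rewrite scale0r.
Qed.

Lemma affine_conv K (mu : E -> R) (a : E) (b : R) (f : E -> R) :
  (forall y, conv K y -> f y = dotp a y + b) -> \sum_(z <- K) mu z = 1 ->
  conv K (\sum_(z <- K) mu z *: z) ->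
  f (\sum_(z <- K) mu z *: z) = \sum_(z <- K) mu z * f z.
Proof.
move=> fa mu1 cx; rewrite fa// dotp_sumr -[b]mul1r -mu1 mulr_suml -big_split/=.
rewrite big_seq [RHS]big_seq; apply: eq_bigr => z zK.
by rewrite dotpZr fa ?mulrDr//; exact: conv_vertex.
Qed.

Lemma conv_bound K x i : conv K x -> `|x ord0 i| <= \sum_(z <- K) `|z ord0 i|.
Proof.
move=> [mu [mu0 mu1 ->]]; rewrite summxE; apply: le_trans (ler_norm_sum _ _ _) _.
rewrite big_seq [leRHS]big_seq; apply: ler_sum => z zK.
rewrite mxE normrM (ger0_norm (mu0 _ zK)) ler_piMl// -mu1 (bigD1_seq z)//= lerDl.
by rewrite big_seq_cond; apply: sumr_ge0 => y /andP[yK _]; exact: mu0.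
Qed.

Lemma enorm_hdiam K x y : conv K x -> conv K y -> enorm (x - y) <= hdiam K.
Proof.
move=> cx cy; apply: ub_le_sup; last by exists x, y.
(* [sup] dominates its set only if some upper bound exists; this one is crude and serves no other
   purpose. *)
exists (Num.sqrt (\sum_(i < n) (2 * \sum_(z <- K) `|z ord0 i|) ^+ 2)) => _ [x' [y' [cx' cy' ->]]].
apply: ler_wsqrtr; apply: ler_sum => i _; rewrite !mxE -expr2.
have := conv_bound i cx'; have := conv_bound i cy'.
by rewrite !ler_norml => /andP[h1 h2] /andP[h3 h4]; nra.
Qed.

End simplex.

(** * Mass lumping in space *)

Section lumping.
Variables (R : realType) (d : nat).
Local Notation E := 'rV[R]_d.
Variables (Om : set E) (Th : {fset {fset E}}) (phi : E -> E -> R).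
Hypothesis d_gt0 : (0 < d)%N.
Hypothesis Om_open : open Om.
Hypothesis Om_bounded : bounded_set Om.
Hypothesis Th_mesh : simplicial_mesh Om Th.
Hypothesis phi_basis : nodal_basis Om Th phi.

Implicit Types f u w : E -> R.

Definition piecewise_affine f (a : {fset E} -> E) (b : {fset E} -> R) :=
  forall K, K \in Th -> forall x, conv K x -> f x = dotp (a K) x + b K.

(* Unlike [Vh Om Th], this class is visibly stable under linear combinations. *)
Definition discrete f : Prop :=
  [/\ H1 Om f, exists a b, piecewise_affine f a b &
      forall z, z \in vertices Th -> z \notin inner_vertices Om Th -> f z = 0].

(** The hat functions of the inner vertices span [Vh] and vanish at all other vertices, hence so
    does [f] at the boundary ones. *)
Lemma Vh_discrete f : Vh Om Th f -> discrete f.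
Proof.
move=> Vf; have [[H1f _] aff _] := Vf; split=> //.
  have /choice[a /choice[b ab]] : forall K, exists a, exists b,
      K \in Th -> forall x, conv K x -> f x = dotp a x + b.
    move=> K; have [/aff[a [b ab]]|_] := boolP (K \in Th); first by exists a, b.
    by exists 0, 0.
  by exists a, b.
move=> z zTh zin; have [_ phiE /(_ _ Vf)[c ->]] := phi_basis.
rewrite big_seq; apply: big1 => z' z'in; rewrite phiE//.
by case: eqP => [e|_]; rewrite ?mulr0//; move: zin; rewrite -e z'in.
Qed.

Lemma discrete_lin (s t : R) f u : discrete f -> discrete u ->
  discrete (fun x => s * f x + t * u x).
Proof.
move=> [[g wg] [a [b ab]] f0] [[g' wg'] [a' [b' ab']] f0']; split.
- exists (fun x => s *: g x + t *: g' x).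
  by apply: weak_gradient_lin => //; exact: measurable_open.
- exists (fun K => s *: a K + t *: a' K), (fun K => s * b K + t * b' K) => K KTh x Kx.
  rewrite (ab _ KTh _ Kx) (ab' _ KTh _ Kx).
  have dC (p q : E) : dotp p q = dotp q p by apply: eq_bigr => i _; rewrite mulrC.
  by rewrite [in RHS]dC dotpDr !dotpZr ![dotp x _]dC; ring.
- by move=> z z1 z2; rewrite f0// f0'// !mulr0 addr0.
Qed.

Lemma grad_weak f : H1 Om f -> weak_gradient Om f (grad Om f).
Proof. by move=> Hf; rewrite /grad; apply: (@xgetPex _ (cst 0) [set g | weak_gradient Om f g]). Qed.

Lemma ae_forall_mesh (P : {fset E} -> E -> Prop) :
  (forall K, K \in Th -> {ae leb, forall x, P K x}) ->
  {ae leb, forall x K, K \in Th -> P K x}.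
Proof.
move=> H.
have : {ae leb, forall x (i : 'I_(size (enum_fset Th))), P (nth fset0 (enum_fset Th) i) x}.
  apply: filter_forall => i; apply: H.
  by rewrite -[_ \in Th]/(_ \in enum_fset Th) mem_nth.
apply: filterS => x h K KTh.
have iK : (index K (enum_fset Th) < size (enum_fset Th))%N by rewrite index_mem.
by have := h (Ordinal iK); rewrite /= nth_index.
Qed.

(** The part of [Om] interior to a simplex is a countable union of boxes, on each of which the weak
    gradient is known up to a null set. *)
Lemma ae_grad f a b : H1 Om f -> piecewise_affine f a b ->
  {ae leb, forall x K, K \in Th -> Om x -> (conv K)^° x -> grad Om f x = a K}.
Proof.
move=> Hf ab; apply: ae_forall_mesh => K KTh.
have /open_bigcup_box[P [l [r UE]]] : open (Om `&` (conv K)^°).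
  by apply: openI => //; exact: open_interior.
(* The guard [P m] sits inside the property, so that the statement holds for every index and
   countable intersection applies. *)
have H m : {ae leb, forall x, P m -> box (l m) (r m) x -> grad Om f x = a K}.
  have [Pm|nPm] := pselect (P m); last by apply: aeW.
  have sub : box (l m) (r m) `<=` Om `&` (conv K)^°.
    by rewrite UE => x bx; exists m.
  have := weak_gradient_affine (measurable_open Om_open) (grad_weak Hf)
    (subset_trans sub (@subIsetl _ _ _)) (a := a K) (b := b K).
  move=> h; have {h} := h (fun x bx => ab K KTh x (interior_subset (sub x bx).2)).
  by apply: filterS => x hx _; exact: hx.
have := ae_foralln H; apply: filterS => x h Omx Kx.
by have : (Om `&` (conv K)^°) x by []; rewrite UE => -[m Pm]; exact: h.
Qed.

Lemma ae_mesh_interior :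
  {ae leb, forall x, Om x -> exists2 K, K \in Th & (conv K)^° x}.
Proof.
have [simpl cover _] := Th_mesh.
have : {ae leb, forall x K, K \in Th -> conv K x -> (conv K)^° x}.
  by apply: ae_forall_mesh => K /simpl[cK iK]; exact: ae_conv_interior.
apply: filterS => x h Omx.
have : closure Om x by exact: subset_closure.
by rewrite -cover => -[K /= KTh Kx]; exists K => //; exact: h.
Qed.

(** Nodal interpolant of [u * w] when these vanish at the boundary vertices; its integral is the
    mass-lumped product. *)
Definition lump u w (x : E) : R :=
  \sum_(z <- inner_vertices Om Th) phi z x * u z * w z.

Lemma lump_pointwise (H2 s : R) u w a b a' b' K x : 0 < s ->
  discrete u -> discrete w ->
  piecewise_affine u a b -> piecewise_affine w a' b' ->
  K \in Th -> hdiam K ^+ 2 <= H2 -> conv K x ->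
  `|lump u w x - u x * w x| <=
  H2 / 4 * (s * dotp (a K) (a K) + dotp (a' K) (a' K) / s).
Proof.
move=> s0 [_ _ u0] [_ _ w0] ab ab' KTh hK cx.
have [mu [mu0 mu1 xE]] := cx.
have KV z : z \in K -> z \in vertices Th.
  by move=> zK; apply/bigfcupP; exists K => //; rewrite KTh.
rewrite xE in cx *.
rewrite (affine_conv (ab K KTh))// (affine_conv (ab' K KTh))//.
(* On the simplex each hat function is affine with nodal values 0 or 1, so it returns the weight
   [mu] of its vertex; vertices outside the inner ones contribute nothing because [u] vanishes
   there. *)
have -> : lump u w (\sum_(z <- K) mu z *: z) = \sum_(z <- K) mu z * (u z * w z).
  rewrite /lump.
  transitivity (\sum_(z' <- inner_vertices Om Th) \sum_(z <- K)
      mu z * (z' == z)%:R * (u z' * w z')).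
    rewrite big_seq [RHS]big_seq; apply: eq_bigr => z' z'in.
    have [Vphi phiE _] := phi_basis; have [_ phia _] := Vphi _ z'in.
    have [c [e ce]] := phia _ KTh.
    rewrite (affine_conv ce)// -mulrA mulr_suml big_seq [RHS]big_seq.
    by apply: eq_bigr => z zK; rewrite phiE//; exact: KV.
  rewrite exchange_big/= big_seq [RHS]big_seq; apply: eq_bigr => z zK.
  have [zin|zin] := boolP (z \in inner_vertices Om Th).
    rewrite (bigD1_seq z) ?fset_uniq//= eqxx mulr1 big1 ?addr0// => z' /negPf ->.
    by rewrite mulr0 mul0r.
  rewrite u0 ?KV// mul0r mulr0 big_seq; apply: big1 => z' z'in.
  case: eqP => [e|_]; last by rewrite mulr0 mul0r.
  by move: zin; rewrite -e z'in.
have := sum_covariance (enum_fset K) mu u w; rewrite mu1 mulr1 => cov.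
set A := (_ - _); have -> : A = 2^-1 * \sum_(i <- K) \sum_(j <- K)
    mu i * mu j * ((u i - u j) * (w i - w j)).
  by rewrite cov mulrA mulVf// mul1r.
have hK0 : 0 <= H2 by exact: le_trans (sqr_ge0 _) hK.
(* Uniform bound for the product of differences. The weights [mu i * mu j] add up to 1, so averaging
   keeps it, whatever the number of vertices. *)
pose Q := 2^-1 * (H2 * (s * dotp (a K) (a K) + dotp (a' K) (a' K) / s)).
have step i j : i \in K -> j \in K ->
    `|mu i * mu j * ((u i - u j) * (w i - w j))| <= mu i * mu j * Q.
  move=> iK jK; rewrite normrM ger0_norm ?mulr_ge0 ?mu0//.
  apply: ler_wpM2l; first by rewrite mulr_ge0 ?mu0.
  have cK z (zK : z \in K) := conv_vertex zK.
  rewrite (ab K KTh i) ?(ab K KTh j) ?(ab' K KTh i) ?(ab' K KTh j); try exact: cK.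
  have sub c e : dotp c i + e - (dotp c j + e) = dotp c (i - j).
    by rewrite dotpBr; ring.
  rewrite !sub.
  apply: le_trans (young_norm _ _ s0) _; rewrite /Q ler_pM2l//.
  have dij : dotp (i - j) (i - j) <= H2.
    rewrite -enorm_sqr; apply: le_trans hK; rewrite ler_sqr ?nnegrE ?sqrtr_ge0//.
      by apply: enorm_hdiam; exact: cK.
    by apply: le_trans (enorm_hdiam (cK i iK) (cK i iK)); exact: sqrtr_ge0.
  rewrite mulrDr; apply: lerD.
    rewrite [leRHS]mulrCA ler_pM2l// mulrC; apply: le_trans (dotp_cauchy_schwarz _ _) _.
    by rewrite ler_wpM2l// dotp_ge0.
  rewrite mulrA ler_pM2r ?invr_gt0// mulrC; apply: le_trans (dotp_cauchy_schwarz _ _) _.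
  by rewrite ler_wpM2l// dotp_ge0.
have : `|\sum_(i <- K) \sum_(j <- K) mu i * mu j * ((u i - u j) * (w i - w j))| <= Q.
  apply: le_trans (ler_norm_sum _ _ _) _.
  have -> : Q = \sum_(i <- K) \sum_(j <- K) mu i * mu j * Q.
    by under eq_bigr do rewrite -mulr_suml -mulr_sumr mu1 mulr1; rewrite -mulr_suml mu1 mul1r.
  rewrite big_seq [leRHS]big_seq; apply: ler_sum => i iK.
  apply: le_trans (ler_norm_sum _ _ _) _.
  by rewrite big_seq [leRHS]big_seq; apply: ler_sum => j jK; exact: step.
move=> h; rewrite normrM ger0_norm//; apply: le_trans (ler_wpM2l _ h) _ => //.
by rewrite /Q; lra.
Qed.

End lumping.

Section lumping_estimate.
Variables (R : realType) (d : nat).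
Local Notation E := 'rV[R]_d.
Variables (Om : set E) (Th : {fset {fset E}}) (phi : E -> E -> R).
Hypothesis d_gt0 : (0 < d)%N.
Hypothesis Om_open : open Om.
Hypothesis Om_bounded : bounded_set Om.
Hypothesis Th_mesh : simplicial_mesh Om Th.
Hypothesis phi_basis : nodal_basis Om Th phi.

Implicit Types f u w : E -> R.

Let mOm : measurable Om := measurable_open Om_open.
Let Om_fin : (leb Om < +oo)%E := leb_bounded_lty mOm Om_bounded.

Lemma H1_L2 f : H1 Om f -> L2 Om f.
Proof. by move=> [g []]. Qed.

Lemma integrable_grad f : H1 Om f ->
  leb.-integrable Om (EFin \o (fun x => dotp (grad Om f x) (grad Om f x))).
Proof.
move=> /grad_weak[_ gL2 _].
apply: (Rintegral_sum mOm _).1 => i _; exact: L2_integrable_mul.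
Qed.

Lemma grad_norm_sqr f :
  grad_norm Om f ^+ 2 = \int[leb]_(x in Om) dotp (grad Om f x) (grad Om f x).
Proof.
rewrite /grad_norm sqr_sqrtr//; apply: Rintegral_ge0 => x _; exact: dotp_ge0.
Qed.

(** The chosen gradients of [c * f] and [f] are compared through the slopes: almost everywhere they
    equal [c *: a K] and [a K]. *)
Lemma grad_norm_scale (c : R) f : discrete Om Th f ->
  grad_norm Om (fun x => c * f x) ^+ 2 = c ^+ 2 * grad_norm Om f ^+ 2.
Proof.
move=> df; have [Hf [a [b ab]] _] := df.
have [Hcf _ _] : discrete Om Th (fun x => c * f x).
  have := discrete_lin Om_open Om_bounded c 0 df df.
  by rewrite (_ : (fun x => _) = fun x => c * f x)//; apply/funext => x; rewrite mul0r addr0.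
have cab : piecewise_affine Th (fun x => c * f x) (fun K => c *: a K) (fun K => c * b K).
  move=> K KTh x Kx; rewrite (ab _ KTh _ Kx) mulrDr; congr (_ + _).
  by rewrite mulr_sumr; apply: eq_bigr => i _; rewrite mxE mulrA.
apply: (eq_trans (grad_norm_sqr (fun x => c * f x))).
rewrite (grad_norm_sqr f).
rewrite -(RintegralZl (c ^+ 2) mOm (integrable_grad Hf)).
congr fine; apply: ae_eq_integral => //.
- exact: measurable_int (integrable_grad Hcf).
- have := integrableZl mOm (c ^+ 2) (integrable_grad Hf).
  by move=> /measurable_int.
have h1 := ae_grad Om_open Hf ab; have h2 := ae_grad Om_open Hcf cab.
have h3 := ae_mesh_interior d_gt0 Th_mesh.
apply: filterS3 h1 h2 h3 => x h1 h2 h3 Omx.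
have [K KTh Kx] := h3 Omx; rewrite (h1 K)// (h2 K)//.
congr (_%:E); rewrite mulr_sumr; apply: eq_bigr => i _.
by rewrite !mxE; ring.
Qed.

Lemma lumped_ipE u w : leb.-integrable Om (EFin \o lump Om Th phi u w) /\
  lumped_ip Om Th phi u w = \int[leb]_(x in Om) lump Om Th phi u w x.
Proof.
have i1 z : z \in inner_vertices Om Th -> leb.-integrable Om (EFin \o phi z).
  have [Vphi _ _] := phi_basis; move=> /Vphi[[/H1_L2 h _] _ _].
  exact: L2_integrable.
have i2 z : z \in enum_fset (inner_vertices Om Th) ->
    leb.-integrable Om (EFin \o (fun x => phi z x * u z * w z)).
  move=> zin; have := integrableZl mOm (u z * w z) (i1 z zin).
  by apply: eq_integrable => // x _ /=; rewrite -EFinM; congr (_%:E); ring.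
have [h1 h2] := Rintegral_sum mOm i2; split=> //.
rewrite /lump h2 /lumped_ip big_seq [RHS]big_seq; apply: eq_bigr => z zin.
rewrite /ip; under eq_Rintegral do rewrite mulr1.
have i3 := i1 z zin.
transitivity (\int[leb]_(x in Om) (phi z x * (u z * w z))).
  by rewrite RintegralZr// mulrA.
by apply: eq_Rintegral => x _; rewrite mulrA.
Qed.

(* The energies are named [gu] and [gw] to keep unification from unfolding [grad]. *)
Lemma lumping_estimate_aux (H2 s gu gw : R) u w : 0 < s -> 0 <= H2 ->
  (forall K, K \in Th -> hdiam K ^+ 2 <= H2) ->
  discrete Om Th u -> discrete Om Th w ->
  gu = \int[leb]_(x in Om) dotp (grad Om u x) (grad Om u x) ->
  gw = \int[leb]_(x in Om) dotp (grad Om w x) (grad Om w x) ->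
  `|ip Om u w - lumped_ip Om Th phi u w| <= H2 / 4 * (s * gu + gw / s).
Proof.
move=> s0 H20 hK du dw guE gwE.
have [Hu [a [b ab]] _] := du; have [Hw [a' [b' ab']] _] := dw.
have [il lE] := lumped_ipE u w.
have iuw : leb.-integrable Om (EFin \o (fun x => u x * w x)).
  by apply: L2_integrable_mul => //; exact: H1_L2.
rewrite distrC lE /ip -RintegralB//.
have iD : leb.-integrable Om (EFin \o (fun x => lump Om Th phi u w x - u x * w x)).
  by have := integrableB mOm il iuw; apply: eq_integrable.
apply: le_trans (le_normr_Rintegral mOm iD) _.
have iGu := integrable_grad Hu; have iGw := integrable_grad Hw.
pose G x := H2 / 4 * s * dotp (grad Om u x) (grad Om u x) +
  H2 / 4 / s * dotp (grad Om w x) (grad Om w x).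
have iG : leb.-integrable Om (EFin \o G) by exact: integrable_lin.
have -> : H2 / 4 * (s * gu + gw / s) = \int[leb]_(x in Om) G x.
  rewrite /G RintegralD//.
  - rewrite (RintegralZl (H2 / 4 * s) mOm iGu) (RintegralZl (H2 / 4 / s) mOm iGw) -guE -gwE.
    by field; rewrite gt_eqF.
  - by have := integrableZl mOm (H2 / 4 * s) iGu; apply: eq_integrable.
  - by have := integrableZl mOm (H2 / 4 / s) iGw; apply: eq_integrable.
apply: fine_le.
- by apply: integrable_fin_num => //; exact: integrable_abse iD.
- exact: integrable_fin_num.
have G0 x : 0 <= G x.
  by rewrite addr_ge0// mulr_ge0 ?dotp_ge0 ?mulr_ge0 ?divr_ge0 ?invr_ge0// ltW.
apply: ae_ge0_le_integral => //.
- apply/measurable_EFinP; apply: measurableT_comp => //; apply/measurable_EFinP.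
  exact: measurable_int iD.
- by move=> x _; rewrite lee_fin G0.
- exact: measurable_int iG.
have h1 := ae_grad Om_open Hu ab; have h2 := ae_grad Om_open Hw ab'.
have h3 := ae_mesh_interior d_gt0 Th_mesh.
apply: filterS3 h1 h2 h3 => x h1 h2 h3 Omx.
have [K KTh Kx] := h3 Omx; rewrite lee_fin.
apply: le_trans (lump_pointwise phi_basis s0 du dw ab ab' KTh (hK _ KTh) (interior_subset Kx)) _.
rewrite /G (h1 K)// (h2 K)// le_eqVlt; apply/orP; left; apply/eqP.
by field; rewrite gt_eqF.
Qed.

Lemma lumping_estimate (H2 s gu gw : R) u w : 0 < s -> 0 <= H2 ->
  (forall K, K \in Th -> hdiam K ^+ 2 <= H2) ->
  discrete Om Th u -> discrete Om Th w ->
  grad_norm Om u ^+ 2 = gu -> grad_norm Om w ^+ 2 = gw ->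
  `|ip Om u w - lumped_ip Om Th phi u w| <= H2 / 4 * (s * gu + gw / s).
Proof.
move=> s0 H20 hK du dw <- <-.
exact: (lumping_estimate_aux s0 H20 hK du dw (grad_norm_sqr u) (grad_norm_sqr w)).
Qed.

End lumping_estimate.

(** * Integration in time *)

Section piecewise_integral.
Variable R : realType.
Local Notation mu1 := (@lebesgue_measure R).
Implicit Types f g : R -> R.

Lemma integrable_itv_bndo_bndc (a : itv_bound R) (r : R) f :
  mu1.-integrable [set` Interval a (BLeft r)] (EFin \o f) ->
  mu1.-integrable [set` Interval a (BRight r)] (EFin \o f).
Proof.
move=> /integrableP[mf foo]; apply/integrableP; split.
  exact/emeasurable_fun_itv_bndo_bndcP.
by rewrite -integral_itv_bndo_bndc//; exact: measurableT_comp.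
Qed.

Lemma Rintegral_itv_split (a b c : R) f : a < b -> b < c ->
  mu1.-integrable `]a, b[ (EFin \o f) -> mu1.-integrable `]b, c[ (EFin \o f) ->
  mu1.-integrable `]a, c[ (EFin \o f) /\
  \int[mu1]_(t in `]a, c[) f t = \int[mu1]_(t in `]a, b[) f t + \int[mu1]_(t in `]b, c[) f t.
Proof.
move=> ab bc fab fbc.
have fab' := integrable_itv_bndo_bndc fab.
have E0 : `]a, c[%classic = `]a, b] `|` `]b, c[ :> set R.
  by apply: itv_bndbnd_setU; rewrite bnd_simp ?ltW.
have dis : [disjoint `]a, b]%classic & `]b, c[%classic].
  apply/disj_setPS => t [] /=; rewrite !in_itv/= => /andP[_ tb] /andP[bt _].
  by move: bt; rewrite ltNge tb.
have fac : mu1.-integrable `]a, c[ (EFin \o f).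
  rewrite E0; apply/integrableP; split.
    by apply/measurable_funU => //; split; [exact: measurable_int fab'|exact: measurable_int fbc].
  rewrite ge0_integral_setU//.
  - rewrite lte_add_pinfty//; first by case/integrableP: fab'.
    by case/integrableP: fbc.
  - apply/measurable_funU => //.
    by split; apply: measurableT_comp => //; [exact: measurable_int fab'|exact: measurable_int fbc].
split=> //; rewrite E0 Rintegral_setU//; last by rewrite -E0.
by congr (_ + _); rewrite Rintegral_itv_bndo_bndc.
Qed.

Lemma integrable_continuous_itv (a b : R) f : continuous f ->
  mu1.-integrable `]a, b[ (EFin \o f).
Proof.
move=> cf; have h : mu1.-integrable `[a, b] (EFin \o f).
  apply: continuous_compact_integrable; first exact: segment_compact.
  exact: continuous_subspaceT.
by apply: integrableS h => //; apply: subset_itv; rewrite bnd_simp.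
Qed.

(** Nothing is asked of [f] at the nodes, a null set. The induction also carries [tn 0 < tn m] and
    integrability, which the splitting of the integral requires. *)
Lemma Rintegral_piecewise (N : nat) (tn : nat -> R) f (F : nat -> R -> R) :
  (forall n, (n < N)%N -> tn n < tn n.+1) ->
  (forall n, (n < N)%N -> continuous (F n)) ->
  (forall n t, (n < N)%N -> t \in `]tn n, tn n.+1[ -> f t = F n t) ->
  \int[mu1]_(t in `]tn 0%N, tn N[) f t = \sum_(n < N) \int[mu1]_(t in `]tn n, tn n.+1[) F n t.
Proof.
move=> tnS cF fF.
suff H m : (m <= N)%N -> [/\ (0 < m)%N -> tn 0%N < tn m,
    mu1.-integrable `]tn 0%N, tn m[ (EFin \o f) &
    \int[mu1]_(t in `]tn 0%N, tn m[) f t = \sum_(n < m) \int[mu1]_(t in `]tn n, tn n.+1[) F n t].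
  by have [] := H N (leqnn _).
elim: m => [_|m IH mN].
  rewrite set_itvoo0 big_ord0 Rintegral_set0; split=> //; exact: integrable_set0.
have [t0m im mE] := IH (ltnW mN).
have fFm : {in `]tn m, tn m.+1[%classic, f =1 F m}.
  by move=> t; rewrite inE/= => tm; exact: fF.
have im' : mu1.-integrable `]tn m, tn m.+1[ (EFin \o f).
  have := @integrable_continuous_itv (tn m) (tn m.+1) _ (cF m mN).
  by apply: eq_integrable => // t tm /=; rewrite fFm.
(* For [m = 0] the left interval is empty and there is nothing to split. *)
have [m0|m0] := posnP m.
  rewrite m0 in fFm im' mN *; split => //; first by move=> _; exact: tnS.
  by rewrite big_ord1; exact: eq_Rintegral.
have [h1 h2] := Rintegral_itv_split (t0m m0) (tnS _ mN) im im'.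
split=> //; first by move=> _; exact: lt_trans (t0m m0) (tnS _ mN).
by rewrite h2 mE big_ord_recr/=; congr (_ + _); exact: eq_Rintegral.
Qed.

Lemma Rintegral_itv_cst (a b c : R) : a < b ->
  \int[mu1]_(t in `]a, b[) c = c * (b - a).
Proof.
by move=> ab; rewrite Rintegral_cst//= lebesgue_measure_itv/= lte_fin ab.
Qed.

(** The ramp runs from 0 to 1 if [c = a] and from -1 to 0 if [c = b]: these are the time factors of
    [v - I1 v] and [v - I2 v]. *)
Lemma Rintegral_sqr_ramp (a b c : R) : a < b -> c = a \/ c = b ->
  \int[mu1]_(t in `]a, b[) ((t - c) / (b - a)) ^+ 2 = (b - a) / 3.
Proof.
move=> ab cab.
have ba0 : b - a != 0 by rewrite subr_eq0 gt_eqF.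
pose F t := (b - a) / 3 * ((t - c) / (b - a)) ^+ 3.
have cf : continuous (fun t : R => ((t - c) / (b - a)) ^+ 2).
  move=> t; apply: cvgM; (apply: cvgM; last exact: cvg_cst);
    by apply: cvgB; [exact: cvg_id|exact: cvg_cst].
have dF (t : R) : is_derive t 1 F (((t - c) / (b - a)) ^+ 2).
  rewrite /F; apply: is_derive_eq.
  by rewrite /GRing.scale/=; field.
have cF : continuous F.
  by move=> t; apply/differentiable_continuous/derivable1_diffP; case: (dF t).
rewrite /Rintegral -(integral_itv_bndoo true false); last first.
  by apply: measurable_funTS; apply/measurable_EFinP; exact: continuous_measurable_fun.
rewrite (@continuous_FTC2 _ _ F)//=.
- by rewrite /F; case: cab => ->; field.
- exact: continuous_subspaceT.
- split; first by move=> t _; case: (dF t).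
  + by apply: cvg_at_right_filter; exact: cF.
  + by apply: cvg_at_left_filter; exact: cF.
- by move=> t _; rewrite derive1E; case: (dF t).
Qed.

End piecewise_integral.

Section time_estimate.
Variables (R : realType) (d : nat).
Local Notation E := 'rV[R]_d.
Local Notation mu1 := (@lebesgue_measure R).
Variables (Om : set E) (Th : {fset {fset E}}) (phi : E -> E -> R).
Hypothesis d_gt0 : (0 < d)%N.
Hypothesis Om_open : open Om.
Hypothesis Om_bounded : bounded_set Om.
Hypothesis Th_mesh : simplicial_mesh Om Th.
Hypothesis phi_basis : nodal_basis Om Th phi.
Variables (T CTJ : R) (N : nat) (tn : nat -> R).
Hypothesis CTJ_gt0 : 0 < CTJ.
Hypothesis tn_part : time_partition N tn T.
Hypothesis tau_h : forall n K, (n < N)%N -> K \in Th ->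
  CTJ * hdiam K ^+ 2 <= tau tn n.

Let tnS n : (n < N)%N -> tn n < tn n.+1. Proof. by case: tn_part => _ _; exact. Qed.

Lemma tau_gt0 n : (n < N)%N -> 0 < tau tn n.
Proof. by move=> nN; rewrite subr_gt0; exact: tnS. Qed.

Lemma tn_le i j : (i <= j)%N -> (j <= N)%N -> tn i <= tn j.
Proof.
move=> /subnK <-; elim: (j - i)%N => // k IH kN.
by apply: le_trans (IH (ltnW kN)) (ltW (tnS kN)).
Qed.

Lemma tn_itv n t : (n < N)%N -> t \in `]tn n, tn n.+1[ -> t \in `]tn 0%N, tn N[.
Proof.
move=> nN; rewrite !in_itv/= => /andP[h1 h2].
rewrite (le_lt_trans _ h1) ?(lt_le_trans h2)//.
  exact: (tn_le nN (leqnn N)).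
exact: (tn_le (leq0n n) (ltnW nN)).
Qed.

(** A sample time in the open interval, where piecewise constant functions take their value; at the
    nodes they may differ from it. *)
Definition midt n : R := (tn n + tn n.+1) / 2.

Lemma midt_itv n : (n < N)%N -> midt n \in `]tn n, tn n.+1[.
Proof. by move=> nN; have := tnS nN; rewrite in_itv/= /midt => h; apply/andP; split; lra. Qed.

(** For positive A and B take [s = B / A]: the two terms become 3/4 and 1/4 of [c * (A * B)]. If A
    or B is 0, this is replaced by letting [s] tend to infinity or to 0. *)
Lemma young_optimize (x c A B : R) : 0 <= A -> 0 <= B -> 0 <= c ->
  (forall s, 0 < s -> x <= c / 4 * (3 * s * A ^+ 2 + B ^+ 2 / s)) ->
  x <= c * (A * B).
Proof.
rewrite le_eqVlt => /predU1P[<-|A0] B0 c0 h.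
  rewrite mul0r mulr0; apply/ler_addgt0Pr => e e0; rewrite add0r.
  (* Makes [c * B ^+ 2 / (4 * s)] at most [e]; the added 1 keeps [s] positive. *)
  pose s := (c * B ^+ 2 + 1) / (4 * e).
  have cB : 0 <= c * B ^+ 2 by rewrite mulr_ge0 ?sqr_ge0.
  have s0 : 0 < s by rewrite divr_gt0 ?mulr_gt0// ltr_wpDl.
  apply: le_trans (h s s0) _.
  rewrite expr0n/= mulr0 add0r mulrA ler_pdivrMr//.
  have -> : e * s = (c * B ^+ 2 + 1) / 4 by rewrite /s; field; rewrite gt_eqF.
  lra.
have [B1|B1] := eqVneq B 0.
  rewrite B1 !mulr0; apply/ler_addgt0Pr => e e0; rewrite add0r.
  (* Makes the remaining term at most [3 / 4 * e]; the added 1 keeps the denominator positive. *)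
  pose s := e / (c * A ^+ 2 + 1).
  have cA : 0 <= c * A ^+ 2 by rewrite mulr_ge0 ?sqr_ge0.
  have s0 : 0 < s by rewrite divr_gt0// ltr_wpDl.
  apply: le_trans (h s s0) _.
  rewrite B1 expr0n/= mul0r addr0.
  have -> : c / 4 * (3 * s * A ^+ 2) = (3 / 4) * (c * A ^+ 2 / (c * A ^+ 2 + 1)) * e.
    by rewrite /s; field; rewrite gt_eqF// ltr_wpDl.
  rewrite ler_piMl ?ltW//.
  have : c * A ^+ 2 / (c * A ^+ 2 + 1) <= 1.
    by rewrite ler_pdivrMr ?mul1r ?ltr_wpDl// lerDl.
  have : 0 <= c * A ^+ 2 / (c * A ^+ 2 + 1) by rewrite divr_ge0// addr_ge0.
  lra.
have B2 : 0 < B by rewrite lt_neqAle eq_sym B1.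
apply: le_trans (h (B / A) (divr_gt0 B2 A0)) _.
rewrite le_eqVlt; apply/orP; left; apply/eqP.
by field; rewrite !gt_eqF.
Qed.

Lemma X_norm_sqr (w : R -> E -> R) (F : nat -> R -> R) :
  (forall n, (n < N)%N -> continuous (F n)) ->
  (forall n t, (n < N)%N -> t \in `]tn n, tn n.+1[ -> grad_norm Om (w t) ^+ 2 = F n t) ->
  X_norm Om T w ^+ 2 = \sum_(n < N) \int[mu1]_(t in `]tn n, tn n.+1[) F n t.
Proof.
move=> cF wF; rewrite /X_norm sqr_sqrtr; last first.
  by apply: Rintegral_ge0 => t _; exact: sqr_ge0.
have [t0 tN _] := tn_part.
rewrite -{1}t0 -tN; exact: (@Rintegral_piecewise R N tn _ F tnS).
Qed.

Lemma X_norm_ge0 (w : R -> E -> R) : 0 <= X_norm Om T w.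
Proof. exact: sqrtr_ge0. Qed.

(** Common form of both reconstructions: [u] is the time derivative and [e] the difference
    [v - I_i v]. All that matters is that on each interval they are multiples of the same [J n], and
    that the squared ramp has integral [tau / 3]. *)
Lemma time_estimate (J : nat -> E -> R) (theta : nat -> R -> R)
    (u e : R -> E -> R) :
  (forall n, (n < N)%N -> discrete Om Th (J n)) ->
  (forall n, (n < N)%N -> continuous (theta n)) ->
  (forall n, (n < N)%N ->
     \int[mu1]_(t in `]tn n, tn n.+1[) theta n t ^+ 2 = tau tn n / 3) ->
  (forall n t, (n < N)%N -> t \in `]tn n, tn n.+1[ ->
     u t = fun x => - (tau tn n)^-1 * J n x) ->
  (forall n t, (n < N)%N -> t \in `]tn n, tn n.+1[ ->
     e t = fun x => theta n t * J n x) ->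
  (lumping_error N tn Om Th phi T u <= (CTJ^-1 * X_norm Om T e)%:E)%E.
Proof.
move=> dJ ctheta itheta uJ eJ; apply: ge_ereal_sup => _ [w [[wV wc] _] <-].
rewrite lee_fin; set num := Rintegral _ _ _.
have [t0 tN _] := tn_part.
have Ci0 : 0 <= CTJ^-1 by rewrite invr_ge0 ltW.
pose W n := w (midt n).
have dW n : (n < N)%N -> discrete Om Th (W n).
  move=> nN; apply: (Vh_discrete phi_basis); apply: wV.
  exact: tn_itv (midt_itv nN).
have wW n t : (n < N)%N -> t \in `]tn n, tn n.+1[ -> w t = W n.
  by move=> nN tI; apply: wc nN tI (midt_itv nN).
pose al n := grad_norm Om (J n) ^+ 2; pose be n := grad_norm Om (W n) ^+ 2.
have Xw : X_norm Om T w ^+ 2 = \sum_(n < N) be n * tau tn n.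
  rewrite (@X_norm_sqr w (fun n => cst (be n))).
  - by apply: eq_bigr => n _; apply: Rintegral_itv_cst; exact: tnS.
  - by move=> n nN; exact: cst_continuous.
  - by move=> n t nN tI; rewrite (wW n).
have Xe : X_norm Om T e ^+ 2 = \sum_(n < N) al n * (tau tn n / 3).
  have ct n : (n < N)%N -> continuous (fun t => theta n t ^+ 2 * al n).
    move=> nN t; apply: cvgM; last exact: cvg_cst.
    by apply: cvgM; exact: ctheta.
  rewrite (@X_norm_sqr e (fun n t => theta n t ^+ 2 * al n)) //.
  - apply: eq_bigr => n _; rewrite -itheta// mulrC RintegralZr//.
    apply: integrable_continuous_itv => t.
    by apply: cvgM; exact: ctheta.
  - by move=> n t nN tI; rewrite (eJ n)//;
      rewrite (grad_norm_scale d_gt0 Om_open Om_bounded Th_mesh _ (dJ n nN)).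
pose D n := ip Om (fun x => - (tau tn n)^-1 * J n x) (W n) -
  lumped_ip Om Th phi (fun x => - (tau tn n)^-1 * J n x) (W n).
have numE : num = \sum_(n < N) D n * tau tn n.
  rewrite /num -{1}t0 -tN (@Rintegral_piecewise R N tn _ (fun n => cst (D n))) //.
  - by apply: eq_bigr => n _; apply: Rintegral_itv_cst; exact: tnS.
  - by move=> n nN; exact: cst_continuous.
  - by move=> n t nN tI; rewrite (uJ n)// (wW n).
(* The norms are abstracted to variables known only by their squares, so that the rest is real
   arithmetic. *)
suff H xe xw : 0 <= xe -> 0 <= xw -> xe ^+ 2 = \sum_(n < N) al n * (tau tn n / 3) ->
    xw ^+ 2 = \sum_(n < N) be n * tau tn n -> num <= CTJ^-1 * (xe * xw).
  have {}H := H _ _ (X_norm_ge0 e) (X_norm_ge0 w) Xe Xw.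
  (* If the norm of [w] is 0, the quotient is 0 since [0^-1 = 0], and the right-hand side is
     nonnegative. *)
  have := X_norm_ge0 w; rewrite le_eqVlt => /predU1P[<-|X0].
    by rewrite invr0 mulr0 mulr_ge0// X_norm_ge0.
  by rewrite ler_pdivrMr// -mulrA.
move=> xe0 xw0 xeE xwE.
apply: young_optimize => // s s0.
rewrite numE xwE xeE !mulr_sumr mulr_suml -big_split/= mulr_sumr.
apply: ler_sum => -[n nN] _ /=.
have tau0 := tau_gt0 nN.
have dJ' : discrete Om Th (fun x => - (tau tn n)^-1 * J n x).
  have := discrete_lin Om_open Om_bounded (- (tau tn n)^-1) 0 (dJ n nN) (dJ n nN).
  by congr discrete; apply/funext => x; rewrite mul0r addr0.
have hK K : K \in Th -> hdiam K ^+ 2 <= CTJ^-1 * tau tn n.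
  by move=> KTh; rewrite mulrC ler_pdivlMr// mulrC; exact: tau_h.
have gE : grad_norm Om (fun x => - (tau tn n)^-1 * J n x) ^+ 2 = (- (tau tn n)^-1) ^+ 2 * al n.
  exact: grad_norm_scale (dJ n nN).
(* Parameter [tau * s] and mesh bound [tau / CTJ]: as the energy of the derivative is
   [al n / tau ^+ 2], the powers of [tau] balance, leaving [tau * (s * al n + be n / s) / (4 * CTJ)]
   after integration over the interval. *)
have h := lumping_estimate d_gt0 Om_open Om_bounded Th_mesh phi_basis
  (mulr_gt0 tau0 s0) (mulr_ge0 Ci0 (ltW tau0)) hK dJ' (dW n nN) gE (erefl (be n)).
apply: le_trans (ler_wpM2r (ltW tau0) (le_trans (ler_norm _) h)) _.
rewrite le_eqVlt; apply/orP; left; apply/eqP.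
by field; rewrite !gt_eqF.
Qed.

End time_estimate.

(** * Jumps and reconstructions on one time interval *)

Section reconstruction.
Variables (R : realType) (d : nat).
Local Notation E := 'rV[R]_d.
Variables (T : R) (N : nat) (tn : nat -> R) (V : set (E -> R)).
Implicit Types v : R -> E -> R.
Hypothesis tn_part : time_partition N tn T.

Lemma VV_cvg_left v n x : VV N tn V v -> (n < N)%N ->
  v s x @[s --> (tn n.+1)^'-] --> v (midt tn n) x.
Proof.
move=> [_ vc] nN; have [_ _ /(_ n nN) h] := tn_part.
apply: cvg_near_cst; near=> s.
rewrite (vc n s (midt tn n) nN)//; last exact: (midt_itv tn_part nN).
rewrite in_itv/=; apply/andP; split; near: s; [exact: nbhs_left_gt|exact: nbhs_left_lt].
Unshelve. all: by end_near. Qed.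

Lemma VV_cvg_right v n x : VV N tn V v -> (n < N)%N ->
  v s x @[s --> (tn n)^'+] --> v (midt tn n) x.
Proof.
move=> [_ vc] nN; have [_ _ /(_ n nN) h] := tn_part.
apply: cvg_near_cst; near=> s.
rewrite (vc n s (midt tn n) nN)//; last exact: (midt_itv tn_part nN).
rewrite in_itv/=; apply/andP; split; near: s; [exact: nbhs_right_gt|exact: nbhs_right_lt].
Unshelve. all: by end_near. Qed.

(** At an inner node right continuity turns the right limit into the nodal value; at the last node
    [jump] uses that value by definition, so one formula covers both. The case of [VV2] mirrors
    this. *)
Lemma jump_VV1 v n : VV1 N tn V v -> (n < N)%N ->
  jump N tn v n.+1 = fun x => v (midt tn n) x - v (tn n.+1) x.
Proof.
move=> [_ vV vr] nN; apply/funext => x; rewrite /jump /=.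
rewrite (cvg_lim _ (VV_cvg_left (x := x) vV nN))//; congr (_ - _).
case: eqP => // nN1; apply: cvg_lim => //; apply: vr.
by rewrite ltn_neqAle nN andbT; apply/eqP.
Qed.

Lemma jump_VV2 v n : VV2 N tn V v -> (n < N)%N ->
  jump N tn v n = fun x => v (tn n) x - v (midt tn n) x.
Proof.
move=> [_ vV vl] nN; apply/funext => x; rewrite /jump.
rewrite (cvg_lim _ (VV_cvg_right (x := x) vV nN))// (ltn_eqF nN); congr (_ - _).
case: eqP => // n0; apply: cvg_lim => //; apply: vl.
by rewrite (ltnW nN) andbT lt0n; apply/eqP.
Qed.

(** The closed interval on the [m] side covers the half-open intervals of both [I1] and [I2]. *)
Lemma itv_index m n t : (m < N)%N -> (n < N)%N -> t \in `]tn n, tn n.+1[ ->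
  tn m <= t <= tn m.+1 -> m = n.
Proof.
move=> mN nN; rewrite in_itv/= => /andP[h1 h2] /andP[h3 h4].
apply/eqP; rewrite eqn_leq; apply/andP; split; rewrite leqNgt; apply/negP => h.
  by have := le_lt_trans (le_trans (tn_le tn_part h (ltnW mN)) h3) h2; rewrite ltxx.
by have := lt_le_trans (le_lt_trans (tn_le tn_part h (ltnW nN)) h1) h4; rewrite ltxx.
Qed.

Lemma I1_itv v n t x : (n < N)%N -> t \in `]tn n, tn n.+1[ ->
  I1 N tn v t x = v t x - (t - tn n) / tau tn n * jump N tn v n.+1 x.
Proof.
move=> nN tI; rewrite /I1; congr (_ - _).
rewrite (bigD1 (Ordinal nN))//= big1 ?addr0.
  rewrite indicE mem_set ?mul1r//=.
  by move: tI; rewrite !in_itv/= => /andP[/ltW-> ->].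
move=> m mn; rewrite indicE memNset ?mul0r//= in_itv/= => /andP[h1 h2].
move/eqP: mn; apply; apply: val_inj => /=.
by apply: (itv_index (ltn_ord m) nN tI); rewrite h1 ltW.
Qed.

Lemma I2_itv v n t x : (n < N)%N -> t \in `]tn n, tn n.+1[ ->
  I2 N tn v t x = v t x + (tn n.+1 - t) / tau tn n * jump N tn v n x.
Proof.
move=> nN tI; rewrite /I2; congr (_ + _).
rewrite (bigD1 (Ordinal nN))//= big1 ?addr0.
  rewrite indicE mem_set ?mul1r//=.
  by move: tI; rewrite !in_itv/= => /andP[-> /ltW ->].
move=> m mn; rewrite indicE memNset ?mul0r//= in_itv/= => /andP[h1 h2].
move/eqP: mn; apply; apply: val_inj => /=.
by apply: (itv_index (ltn_ord m) nN tI); rewrite h2 ltW.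
Qed.

Lemma Dt_affine (f : R -> E -> R) n t (p q : R) x : t \in `]tn n, tn n.+1[ ->
  (forall s, s \in `]tn n, tn n.+1[ -> f s x = p + q * s) -> Dt f t x = q.
Proof.
move=> tI fE; rewrite /Dt derive1E.
have h : is_derive t (1 : R) (fun s : R => p + q * s) q.
  by apply: is_derive_eq; rewrite /GRing.scale/=; ring.
rewrite -[RHS](@derive_val _ _ _ _ _ _ _ h); apply: near_eq_derive.
have := near_in_itvoo tI; apply: filterS => s sI; exact: fE.
Qed.

Lemma Dt_I1 v n t : VV N tn V v -> (n < N)%N -> t \in `]tn n, tn n.+1[ ->
  Dt (I1 N tn v) t = fun x => - (tau tn n)^-1 * jump N tn v n.+1 x.
Proof.
move=> [_ vc] nN tI; apply/funext => x.
apply: (@Dt_affine _ n _ (v t x + tn n / tau tn n * jump N tn v n.+1 x)) => // s sI.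
by rewrite (I1_itv v x nN sI) (vc n s t nN sI tI); ring.
Qed.

Lemma Dt_I2 v n t : VV N tn V v -> (n < N)%N -> t \in `]tn n, tn n.+1[ ->
  Dt (I2 N tn v) t = fun x => - (tau tn n)^-1 * jump N tn v n x.
Proof.
move=> [_ vc] nN tI; apply/funext => x.
apply: (@Dt_affine _ n _ (v t x + tn n.+1 / tau tn n * jump N tn v n x)) => // s sI.
by rewrite (I2_itv v x nN sI) (vc n s t nN sI tI); ring.
Qed.

End reconstruction.

Unset Implicit Arguments.

Theorem proposition6p2 (R : realType) (CTJ : R) (CTJ_gt0 : 0 < CTJ) :
  exists2 C : R, 0 < C &
  forall (d : nat) (d_gt0 : (0 < d)%N)
    (Om : set 'rV[R]_d) (Om_dom : lipschitz_domain Om)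
    (T : R) (T_gt0 : 0 < T)
    (Th : {fset {fset 'rV[R]_d}}) (Th_mesh : simplicial_mesh Om Th)
    (phi : 'rV[R]_d -> 'rV[R]_d -> R) (phi_basis : nodal_basis Om Th phi)
    (N : nat) (tn : nat -> R) (tn_part : time_partition N tn T)
    (tau_h : forall (n : nat) (K : {fset 'rV[R]_d}), (n < N)%N -> K \in Th ->
       CTJ * hdiam K ^+ 2 <= tau tn n),
  (forall v : R -> 'rV[R]_d -> R, VV1 N tn (Vh Om Th) v ->
     (lumping_error N tn Om Th phi T (Dt (I1 N tn v)) <=
      (C * X_norm Om T (fun t x => v t x - I1 N tn v t x))%:E)%E) /\
  (forall v : R -> 'rV[R]_d -> R, VV2 N tn (Vh Om Th) v ->
     (lumping_error N tn Om Th phi T (Dt (I2 N tn v)) <=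
      (C * X_norm Om T (fun t x => v t x - I2 N tn v t x))%:E)%E).
Proof.
exists CTJ^-1; first by rewrite invr_gt0.
move=> d d_gt0 Om [Om_open _ Om_bounded _] T T_gt0 Th Th_mesh phi phi_basis N tn tn_part tau_h.
have discreteB f g : Vh Om Th f -> Vh Om Th g -> discrete Om Th (fun x => f x - g x).
  move=> /(Vh_discrete phi_basis) df /(Vh_discrete phi_basis) dg.
  have := discrete_lin Om_open Om_bounded 1 (-1) df dg.
  by congr discrete; apply/funext => x; rewrite mul1r mulN1r.
have tnS n : (n < N)%N -> tn n < tn n.+1 by case: tn_part => _ _; exact.
have Vmid v n : VV N tn (Vh Om Th) v -> (n < N)%N -> Vh Om Th (v (midt tn n)).
  by move=> [vV _] nN; apply: vV; exact: (tn_itv tn_part nN (midt_itv tn_part nN)).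
have node n : (n <= N)%N -> tn n \in `[tn 0%N, tn N].
  by move=> nN; rewrite in_itv/= !(tn_le tn_part).
have ramp_cont (c k : R) : continuous (fun t : R => (t - c) / k).
  by move=> t; apply: cvgM; [apply: cvgB; [exact: cvg_id|exact: cvg_cst]|exact: cvg_cst].
split=> v vV.
- have [vVh vVV _] := vV.
  apply: (time_estimate d_gt0 Om_open Om_bounded Th_mesh phi_basis CTJ_gt0 tn_part tau_h
    (* [I1] corrects by the jump at the right end of each interval, hence the shift to [n.+1]. *)
    (J := fun n => jump N tn v n.+1) (theta := fun n t => (t - tn n) / tau tn n)).
  + move=> n nN; rewrite (jump_VV1 tn_part vV nN); apply: discreteB; first exact: Vmid.
    by apply: vVh; exact: node.
  + by move=> n nN; exact: ramp_cont.
  + by move=> n nN; apply: Rintegral_sqr_ramp; [exact: tnS|left].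
  + by move=> n t nN tI; exact: (Dt_I1 tn_part vVV nN tI).
  + move=> n t nN tI; apply/funext => x.
    by rewrite (I1_itv tn_part _ _ nN tI) opprB addrC subrK.
- have [vVh vVV _] := vV.
  apply: (time_estimate d_gt0 Om_open Om_bounded Th_mesh phi_basis CTJ_gt0 tn_part tau_h
    (* [I2] corrects by the jump at the left end; the ramp is taken nonpositive because [v - I2 v]
       is minus the added term. *)
    (J := fun n => jump N tn v n) (theta := fun n t => (t - tn n.+1) / tau tn n)).
  + move=> n nN; rewrite (jump_VV2 tn_part vV nN); apply: discreteB; last exact: Vmid.
    by apply: vVh; exact/node/ltnW.
  + by move=> n nN; exact: ramp_cont.
  + by move=> n nN; apply: Rintegral_sqr_ramp; [exact: tnS|right].
  + by move=> n t nN tI; exact: (Dt_I2 tn_part vVV nN tI).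
  + move=> n t nN tI; apply/funext => x.
    by rewrite (I2_itv tn_part _ _ nN tI) opprD addNKr -!mulNr opprB.
Qed.
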